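(* For any $\delta>0$ there is a constant $C_\delta>0$ depending only on $\delta$ such that for every finite connected (polygonal) 2-complex $X$ with rationally perfect fundamental group $\Gamma$, $$\frac{\xi_2(X;\mathbb{Z})-1}{\kappa_2(X;\mathbb{Z})\operatorname{diam}(X)}\,\rho_1(X;\mathbb{Z})\le C_\delta\,(\#\Gamma^{ab})^{\delta}.$$
   Context: A (polygonal) 2-complex is a cell complex of dimension 2 whose 2-cells are regular polygons with every boundary edge of length $1$, attached along edge loops. This makes the complex a (path) metric space, and $\operatorname{diam}(X)$ is its diameter. A finitely generated group $\Gamma$ is rationally perfect if its abelianization $\Gamma^{ab}$ is finite; $\#$ denotes cardinality. For a finite 2-complex $X$, the cellular chain groups $C_p(X;\mathbb{Z})$ carry the $\ell^1$ norm with respect to the basis of $p$-cells: $\|\sum a_i\sigma_i\|=\sum|a_i|$. For an exact 1-cycle $z\in\partial C_2(X;\mathbb{Z})$ set $\mathsf{fill}_1(z;\mathbb{Z})=\inf\{\|A\| : A\in C_2(X;\mathbb{Z}),\ \partial A=z\}$. Define $$\rho_1(X;\mathbb{Z})=\inf_{0\ne z\in\partial C_2(X;\mathbb{Z})}\frac{\|z\|}{\mathsf{fill}_1(z;\mathbb{Z})}$$ (with the usual conventions $\inf\emptyset=+\infty$, $0\cdot\infty=0$). Since $X$ is a 2-complex, $H_2(X;\mathbb{Z})$ is identified with the group of 2-cycles $\ker(\partial_2)\subset C_2(X;\mathbb{Z})$. If $H_2(X;\mathbb{Z})$ has rank $b>0$, $$\xi_2(X;\mathbb{Z})=\inf\Bigl\{\max_{1\le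 j\le b}\|S_j\| : S_1,\dots,S_b\in H_2(X;\mathbb{Z})\text{ generate a rank } b\text{ subgroup of }H_2(X;\mathbb{Z})\Bigr\},$$ and $\xi_2(X;\mathbb{Z})=0$ if $H_2(X;\mathbb{Z})=0$. The 2-cycle curvature $\kappa_2(X;\mathbb{Z})$ is the maximum, over all 2-cells $\sigma$ in the support of some 2-cycle in $\ker(\partial_2)\subset C_2(X;\mathbb{Z})$, of the length of the boundary of $\sigma$ as a cellular path; if there is no such 2-cell, $\kappa_2(X;\mathbb{Z})$ is the maximal length of the boundary of any 2-cell of $X$. *)

(* Defs.v *)
From Stdlib Require Relation_Operators.
From HB Require Import structures.
From mathcomp Require Import all_boot all_order all_algebra finmap generic_quotient.
From mathcomp Require Import all_classical all_reals all_analysis.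

Set Implicit Arguments.
Unset Strict Implicit.
Unset Printing Implicit Defensive.

Import Order.TTheory GRing.Theory Num.Theory.

Local Open Scope classical_set_scope.
Local Open Scope quotient_scope.
Local Open Scope ring_scope.

(** An edge [e] is oriented from [src e] to [tgt e]; the dart [(e, true)]
    traverses it in that direction and [(e, false)] in the opposite one.
    A 2-cell is given by the closed edge path along which its boundary is
    attached.  Regular polygons have at least three sides; the attaching path
    may have repeated vertices or edges, and backtracking. *)

Definition dart_org (V E : Type) (src tgt : E -> V) (d : E * bool) : V :=
  if d.2 then src d.1 else tgt d.1.

Definition dart_end (V E : Type) (src tgt : E -> V) (d : E * bool) : V :=
  if d.2 then tgt d.1 else src d.1.

Record polycomplex := PolyComplex {
  vertex : finType;
  edge : finType;
  face : finType;
  src : edge -> vertex;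
  tgt : edge -> vertex;
  bd : face -> seq (edge * bool);
  bd_size : forall f, (2 < size (bd f))%N;
  bd_closed : forall f,
    path.cycle (fun d d' => dart_end src tgt d == dart_org src tgt d') (bd f)
}.

Section EdgePaths.
Variable X : polycomplex.

Definition dart : Type := (edge X * bool)%type.
Definition org (d : dart) : vertex X := dart_org (@src X) (@tgt X) d.
Definition fin (d : dart) : vertex X := dart_end (@src X) (@tgt X) d.
Definition flip (d : dart) : dart := (d.1, ~~ d.2).

Fixpoint walk (u : vertex X) (p : seq dart) (w : vertex X) : bool :=
  if p is d :: p' then (org d == u) && walk (fin d) p' w else u == w.

(** Path-connectedness of a cell complex is that of its 1-skeleton. *)
Definition complex_connected : Prop :=
  forall u w : vertex X, exists p, walk u p w.

Definition inv_path (p : seq dart) : seq dart := rev (map flip p).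

Lemma walk_cat u p q w :
  walk u (p ++ q) w <-> exists2 x, walk u p x & walk x q w.
Proof.
elim: p u => [|d p IH] u /=.
  by split=> [h|[x /eqP -> //]]; exists u.
split.
  by case/andP=> hd /IH [x hp hq]; exists x => //; rewrite hd.
by case=> x /andP[hd hp] hq; rewrite hd /=; apply/IH; exists x.
Qed.

Lemma walk_inv u p w : walk u p w -> walk w (inv_path p) u.
Proof.
elim: p u => [|d p IH] u /=; first by rewrite eq_sym.
case/andP=> /eqP <- /IH h; rewrite /inv_path /= rev_cons -cats1.
apply/walk_cat; exists (fin d) => //=.
by case: d {h} => e [] /=; rewrite /org /fin /flip /dart_org /dart_end /= !eqxx.
Qed.

End EdgePaths.

Section FundamentalGroup.
Variables (X : polycomplex) (v : vertex X).

Definition loop := {p : seq (dart X) | walk v p v}.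

(** An elementary homotopy deletes a backtracking pair of darts or a full
    turn around a 2-cell. *)
Variant elem_homotopy (p q : loop) : Prop :=
| Spur u d w of sval p = u ++ [:: d; flip d] ++ w & sval q = u ++ w
| Cell u f w of sval p = u ++ bd f ++ w & sval q = u ++ w.

Definition homotopic : loop -> loop -> Prop :=
  Relation_Operators.clos_refl_sym_trans loop elem_homotopy.

Definition homotopicb (p q : loop) : bool := `[< homotopic p q >].

Lemma homotopicb_refl : reflexive homotopicb.
Proof. by move=> p; apply/asboolP/Relation_Operators.rst_refl. Qed.

Lemma homotopicb_sym : symmetric homotopicb.
Proof.
by move=> p q; apply/asboolP/asboolP => h; apply: Relation_Operators.rst_sym.
Qed.

Lemma homotopicb_trans : transitive homotopicb.
Proof.
move=> q p r /asboolP h1 /asboolP h2; apply/asboolP.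
exact: Relation_Operators.rst_trans h2.
Qed.

Canonical homotopic_equiv :=
  EquivRel homotopicb homotopicb_refl homotopicb_sym homotopicb_trans.

Definition pi1 := {eq_quot homotopicb}.
HB.instance Definition _ : EqQuotient _ homotopicb pi1 := EqQuotient.on pi1.
HB.instance Definition _ := Choice.on pi1.

Definition loop_class (p : loop) : pi1 := \pi_pi1 p.

Lemma loop_classP p q : loop_class p = loop_class q <-> homotopic p q.
Proof.
split=> [/eqP|h]; first by rewrite eqmodE => /asboolP.
by apply/eqP; rewrite eqmodE; exact/asboolP.
Qed.

Lemma loop_one_subproof : walk v [::] v. Proof. by rewrite /=. Qed.
Definition loop_one : loop := exist (fun p => walk v p v) [::] loop_one_subproof.

Lemma loop_mul_subproof (p q : loop) : walk v (sval p ++ sval q) v.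
Proof. by apply/walk_cat; exists v; [exact: (svalP p)|exact: (svalP q)]. Qed.
Definition loop_mul (p q : loop) : loop :=
  exist (fun p => walk v p v) (sval p ++ sval q) (loop_mul_subproof p q).

Definition loop_inv (p : loop) : loop :=
  exist (fun p => walk v p v) (inv_path (sval p)) (walk_inv (svalP p)).

Lemma homotopic_mull p q r :
  homotopic p q -> homotopic (loop_mul p r) (loop_mul q r).
Proof.
elim=> {p q} [p q [u d w hp hq|u f w hp hq]|p|p q _ IH|p q s _ IH1 _ IH2].
- apply: Relation_Operators.rst_step; apply: (@Spur _ _ u d (w ++ sval r)).
    by rewrite /= hp -!catA.
  by rewrite /= hq -!catA.
- apply: Relation_Operators.rst_step; apply: (@Cell _ _ u f (w ++ sval r)).
    by rewrite /= hp -!catA.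
  by rewrite /= hq -!catA.
- exact: Relation_Operators.rst_refl.
- exact: Relation_Operators.rst_sym.
- exact: Relation_Operators.rst_trans IH2.
Qed.

Lemma homotopic_mulr p q r :
  homotopic p q -> homotopic (loop_mul r p) (loop_mul r q).
Proof.
elim=> {p q} [p q [u d w hp hq|u f w hp hq]|p|p q _ IH|p q s _ IH1 _ IH2].
- apply: Relation_Operators.rst_step; apply: (@Spur _ _ (sval r ++ u) d w).
    by rewrite /= hp -!catA.
  by rewrite /= hq -!catA.
- apply: Relation_Operators.rst_step; apply: (@Cell _ _ (sval r ++ u) f w).
    by rewrite /= hp -!catA.
  by rewrite /= hq -!catA.
- exact: Relation_Operators.rst_refl.
- exact: Relation_Operators.rst_sym.
- exact: Relation_Operators.rst_trans IH2.
Qed.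

Lemma homotopic_mulrV p : homotopic (loop_mul p (loop_inv p)) loop_one.
Proof.
suff H s : forall (p q : loop) u w,
    sval p = u ++ s ++ inv_path s ++ w -> sval q = u ++ w -> homotopic p q.
  by apply: (H (sval p) _ _ [::] [::]) => //=; rewrite cats0.
elim: s => [|d s IH] {}p q u w hp hq.
  have -> : p = q by apply/val_inj; rewrite /= hp hq.
  exact: Relation_Operators.rst_refl.
have hr : walk v (u ++ [:: d; flip d] ++ w) v.
  have := svalP q; rewrite hq => /walk_cat [x hu hw].
  have := svalP p; rewrite hp => /walk_cat [y hu' /= /andP[/eqP hd _]].
  have exy : x = y.
    elim: (u) (v) hu hu' => [|a t IHt] z /=; first by move=> /eqP <- /eqP.
    by case/andP=> _ h1 /andP[_ h2]; exact: IHt h1 h2.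
  apply/walk_cat; exists x => //=; rewrite exy -hd eqxx.
  have -> : org (flip d) = fin d by case: (d) => e [].
  have -> : fin (flip d) = org d by case: (d) => e [].
  by rewrite eqxx /= hd -exy.
apply: (@Relation_Operators.rst_trans _ _ _ (exist (fun p => walk v p v) _ hr)); last first.
  exact/Relation_Operators.rst_step/(@Spur _ _ u d w).
apply: (IH _ _ (rcons u d) (flip d :: w)) => /=; last by rewrite cat_rcons.
by rewrite hp cat_rcons /inv_path /= rev_cons cat_rcons.
Qed.

Lemma homotopic_mulVr p : homotopic (loop_mul (loop_inv p) p) loop_one.
Proof.
have flipK : involutive (@flip X) by case=> e [].
have -> : loop_mul (loop_inv p) p = loop_mul (loop_inv p) (loop_inv (loop_inv p)).
  apply/val_inj; rewrite /= /inv_path map_rev revK -map_comp.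
  by congr (_ ++ _); rewrite -[LHS]map_id; apply: eq_map => d /=; rewrite flipK.
exact: homotopic_mulrV.
Qed.

Definition pi1_one : pi1 := loop_class loop_one.
Definition pi1_mul (x y : pi1) : pi1 := loop_class (loop_mul (repr x) (repr y)).
Definition pi1_inv (x : pi1) : pi1 := loop_class (loop_inv (repr x)).

Lemma loop_class_repr (x : pi1) : loop_class (repr x) = x.
Proof. exact: reprK. Qed.

Lemma homotopic_repr p : homotopic (repr (loop_class p)) p.
Proof. by apply/loop_classP; rewrite loop_class_repr. Qed.

Lemma pi1_mul_class p q :
  pi1_mul (loop_class p) (loop_class q) = loop_class (loop_mul p q).
Proof.
apply/loop_classP; apply: (@Relation_Operators.rst_trans _ _ _
  (loop_mul p (repr (loop_class q)))).
  exact/homotopic_mull/homotopic_repr.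
exact/homotopic_mulr/homotopic_repr.
Qed.

Lemma pi1_mulA : associative pi1_mul.
Proof.
move=> x y z.
rewrite -(loop_class_repr x) -(loop_class_repr y) -(loop_class_repr z).
by rewrite !pi1_mul_class; congr loop_class; apply/val_inj; rewrite /= catA.
Qed.

Lemma pi1_mul1g : left_id pi1_one pi1_mul.
Proof.
move=> x; rewrite -(loop_class_repr x) pi1_mul_class.
by congr loop_class; apply/val_inj.
Qed.

Lemma pi1_mulg1 : right_id pi1_one pi1_mul.
Proof.
move=> x; rewrite -(loop_class_repr x) pi1_mul_class.
by congr loop_class; apply/val_inj; rewrite /= cats0.
Qed.

Lemma pi1_mulVg : left_inverse pi1_one pi1_inv pi1_mul.
Proof.
move=> x; rewrite -[X in pi1_mul _ X]loop_class_repr pi1_mul_class.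
exact/loop_classP/homotopic_mulVr.
Qed.

Lemma pi1_mulgV : right_inverse pi1_one pi1_inv pi1_mul.
Proof.
move=> x; rewrite -[X in pi1_mul X _]loop_class_repr pi1_mul_class.
exact/loop_classP/homotopic_mulrV.
Qed.

HB.instance Definition _ := isGroup.Build pi1
  pi1_mulA pi1_mul1g pi1_mulg1 pi1_mulVg pi1_mulgV.

End FundamentalGroup.

Section Abelianization.
Variable G : groupType.

Definition is_subgroup (H : set G) : Prop :=
  H 1%g /\ (forall x y, H x -> H y -> H (x * y^-1)%g).

Definition derived_subgroup : set G :=
  \bigcap_(H in [set H | is_subgroup H /\ forall x y : G, H [~ x, y]%g]) H.

(** The underlying set of G^ab: the cosets of the derived subgroup. *)
Definition abelianization : set (set G) :=
  range (fun x : G => [set (x * h)%g | h in derived_subgroup]).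

(** Finite generation is automatic for the fundamental group of a finite
    complex, the only groups to which this is applied. *)
Definition rationally_perfect : Prop := finite_set abelianization.

Definition card_ab : nat := #|` fset_set abelianization|.

End Abelianization.

Definition l1 (I : finType) (a : {ffun I -> int}) : nat := (\sum_i `|a i|)%N.

Section Rank.
Variable I : finType.
Implicit Type A : set {ffun I -> int}.

Definition zindep k (S : 'I_k -> {ffun I -> int}) : Prop :=
  forall c : 'I_k -> int, \sum_i S i *~ c i = 0 -> forall i, c i = 0.

Definition zspan k (S : 'I_k -> {ffun I -> int}) : set {ffun I -> int} :=
  range (fun c : 'I_k -> int => \sum_i S i *~ c i).

(** Rank of a subgroup of Z^I: the maximal number of Z-independent elements,
    which is at most #|I|. *)
Definition zrank A : nat :=
  \max_(k < #|I|.+1 | `[< exists S : 'I_k -> {ffun I -> int},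
                            (forall i, A (S i)) /\ zindep S >]) k.

End Rank.

Section Chains.
Variables (R : realType) (X : polycomplex).

Definition bd_cell (f : face X) : {ffun edge X -> int} :=
  [ffun e => \sum_(d <- bd f | d.1 == e) (if d.2 then 1 else -1)].

Definition bd2 (A : {ffun face X -> int}) : {ffun edge X -> int} :=
  \sum_f bd_cell f *~ A f.

(** There are no 3-cells, so H_2(X; Z) is the group of 2-cycles. *)
Definition H2 : set {ffun face X -> int} := [set A | bd2 A = 0].

Definition fill1 (z : {ffun edge X -> int}) : R :=
  inf [set (l1 A)%:R | A in [set A | bd2 A = z]].

Definition rho1 : \bar R :=
  ereal_inf [set ((l1 z)%:R / fill1 z)%:E
            | z in [set z | z != 0 /\ range bd2 z]].

Definition xi2 : R :=
  let b := zrank H2 in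
  if b == 0%N then 0 else
  inf [set (\max_(j < b) l1 (S j))%:R
      | S in [set S : 'I_b -> {ffun face X -> int} |
               (forall j, H2 (S j)) /\ zrank (zspan S) = b]].

Definition supports_cycle (f : face X) : bool :=
  `[< exists2 A, H2 A & A f != 0 >].

(** If X has no 2-cell at all, the empty maximum gives 0. *)
Definition kappa2 : nat :=
  if [exists f, supports_cycle f]
  then \max_(f : face X | supports_cycle f) size (bd f)
  else \max_(f : face X) size (bd f).

End Chains.

Section Metric.
Variables (R : realType) (X : polycomplex).

(** Corners of the regular n-gon of side length 1 centred at the origin;
    [corner n n = corner n 0]. *)
Definition corner (n k : nat) : R * R :=
  let r := (2 * sin (pi / n%:R))^-1 in
  let a := 2 * pi * k%:R / n%:R in
  (r * cos a, r * sin a).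

Definition polygon (n : nat) : set (R * R) :=
  [set p | exists w : 'I_n -> R, [/\ forall k, 0 <= w k, \sum_k w k = 1 &
     p = (\sum_k w k * (corner n k).1, \sum_k w k * (corner n k).2)]].

Definition side (n k : nat) (t : R) : R * R :=
  ((1 - t) * (corner n k).1 + t * (corner n k.+1).1,
   (1 - t) * (corner n k).2 + t * (corner n k.+1).2).

Definition euclid (p q : R * R) : R :=
  Num.sqrt ((p.1 - q.1) ^+ 2 + (p.2 - q.2) ^+ 2).

(** X is the quotient of the disjoint union of the vertices, unit intervals
    and polygons satisfying [is_point] by the identifications [glued]. *)
Variant point :=
| at_vertex of vertex X
| at_edge of edge X & R
| at_face of face X & R * R.

Definition is_point (x : point) : Prop :=
  match x with
  | at_vertex _ => True
  | at_edge _ t => 0 <= t <= 1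
  | at_face f p => polygon (size (bd f)) p
  end.

Variant glued : point -> point -> Prop :=
| glue_src e : glued (at_edge e 0) (at_vertex (src e))
| glue_tgt e : glued (at_edge e 1) (at_vertex (tgt e))
| glue_side f (k : 'I_(size (bd f))) t of 0 <= t <= 1 :
    let d := tnth (in_tuple (bd f)) k in
    glued (at_face f (side (size (bd f)) k t))
          (at_edge d.1 (if d.2 then t else 1 - t)).

Variant step : point -> point -> R -> Prop :=
| step_edge e s t of 0 <= s <= 1 & 0 <= t <= 1 :
    step (at_edge e s) (at_edge e t) `|s - t|
| step_face f p q of polygon (size (bd f)) p & polygon (size (bd f)) q :
    step (at_face f p) (at_face f q) (euclid p q)
| step_glue x y of glued x y : step x y 0
| step_unglue x y of glued y x : step x y 0.

(** Broken geodesics in X, each piece lying in a single closed cell, with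
    their length; the path metric is the infimum of these lengths. *)
Inductive string : point -> point -> R -> Prop :=
| string_nil x : string x x 0
| string_cons x y z l m of step x y l & string y z m : string x z (l + m).

Definition path_dist (x y : point) : R := inf [set l | string x y l].

Definition diam : R :=
  sup [set path_dist xy.1 xy.2 | xy in [set xy | is_point xy.1 /\ is_point xy.2]].

End Metric.

(* Main.v *)
Require Import Defs.
From mathcomp Require Import all_boot all_order all_algebra finmap.
From mathcomp Require Import all_classical all_reals all_analysis.
From mathcomp Require Import ring lra zify.

(** A spanning tree of geodesics closes every edge [e] up to a loop whose chain
    [c e] has norm at most [64 diam X], and the boundary of a cell [f] is the
    combination of the [c e] with the coefficients of [bd_cell f]. If every [c e]
    were the boundary of some [A e], the cycles [f - \sum_e bd_cell f e * A e]
    would span H_2, and [rho_1] bounds their norms.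

    In general the [c e] generate, modulo boundaries, a group of order at most
    [N = #Gamma^ab]. Fix [M] with [(M + 1)^delta >= 26]. A maximal family
    [t_1, .., t_r] of edges such that the combinations of the [c t_i] with
    coefficients in [0 .. M] are pairwise inequivalent modulo boundaries satisfies
    [(M + 1)^r <= N], and by maximality some multiple [m e * c e], [1 <= m e <= M],
    is equivalent to a combination of the [c t_i] with coefficients at most [M].
    After multiplication by [M!] it remains to fill, linearly, the lattice of
    relations between the [c t_i]. It has rank at most [r], so a reduced basis
    distorts norms by at most [13^r], and in total the loss is at most
    [26^r <= N^delta]. The additive term [M! - 1] is harmless because
    [rho_1 <= kappa_2] as soon as a cell in the support of a 2-cycle has nonzero
    boundary. *)

Set Implicit Arguments.
Unset Strict Implicit.
Unset Printing Implicit Defensive.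

Import Order.TTheory GRing.Theory Num.Theory.
Import numFieldNormedType.Exports.

Local Open Scope classical_set_scope.
Local Open Scope ring_scope.

(** * Seminorms on abelian groups and reduced generators *)

Section Seminorm.
Variables (R : realType) (V : zmodType) (nu : V -> R).
Hypothesis nuD : forall x y, nu (x + y) <= nu x + nu y.
Hypothesis nuM : forall x (m : int), nu (x *~ m) = `|m|%:~R * nu x.

Lemma seminorm0 : nu 0 = 0.
Proof. by rewrite -(mulr0z 0) nuM normr0 mul0r. Qed.

Lemma seminormN x : nu (- x) = nu x.
Proof. by rewrite -[in LHS](mulr1z x) -mulrNz nuM normrN normr1 mul1r. Qed.

Lemma seminorm_ge0 x : 0 <= nu x.
Proof. by have := nuD x (- x); rewrite subrr seminorm0 seminormN; lra. Qed.

Variable b : V.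

(* The infimum of [nu (x + t b)] over rational [t], written with integer
   coefficients only. *)
Definition quot_seminorm (x : V) : R :=
  inf [set nu (x *~ k.1.+1 + b *~ k.2) / k.1.+1%:R | k in [set: nat * int]].

Lemma quot_seminorm_le x (m : nat) (n : int) : (0 < m)%N ->
  quot_seminorm x <= nu (x *~ m + b *~ n) / m%:R.
Proof.
case: m => // m _; apply: ge_inf; last by exists (m, n).
by exists 0 => _ [k _ <-]; apply: divr_ge0 => //; exact: seminorm_ge0.
Qed.

Lemma le_quot_seminorm x (c : R) :
  (forall (m : nat) (n : int), (0 < m)%N -> c * m%:R <= nu (x *~ m + b *~ n)) ->
  c <= quot_seminorm x.
Proof.
move=> h; apply: lb_le_inf; first by exists (nu (x *~ 1%N + b *~ 0) / 1%:R); exists (0%N, 0).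
by move=> _ [[m n] _ <-] /=; rewrite ler_pdivlMr ?ltr0n//; exact: h.
Qed.

Lemma quot_seminorm_near x (e : R) : 0 < e -> exists (m : nat) (n : int),
  (0 < m)%N /\ nu (x *~ m + b *~ n) < (quot_seminorm x + e) * m%:R.
Proof.
move=> e0; apply: contrapT => h.
suff : quot_seminorm x + e <= quot_seminorm x by lra.
apply: le_quot_seminorm => m n m0; rewrite leNgt; apply/negP => h1.
by apply: h; exists m, n.
Qed.

Lemma quot_seminorm_ge0 x : 0 <= quot_seminorm x.
Proof. by apply: le_quot_seminorm => m n _; rewrite mul0r; exact: seminorm_ge0. Qed.

Lemma quot_seminorm_le1 x n : quot_seminorm x <= nu (x + b *~ n).
Proof. by have := quot_seminorm_le x n (ltn0Sn 0); rewrite mulr1z divr1. Qed.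

Lemma quot_seminormD x y :
  quot_seminorm (x + y) <= quot_seminorm x + quot_seminorm y.
Proof.
apply/ler_addgt0Pr => e e0.
have e2 : 0 < e / 2 by lra.
have [m [n [m0 h]]] := quot_seminorm_near x e2.
have [m' [n' [m0' h']]] := quot_seminorm_near y e2.
have mm0 : (0 < m * m')%N by rewrite muln_gt0 m0.
apply: (le_trans (quot_seminorm_le (x + y) (n *~ m' + n' *~ m) mm0)).
rewrite ler_pdivrMr ?ltr0n//.
have -> : (x + y) *~ (m * m')%N + b *~ (n *~ m' + n' *~ m) =
    (x *~ m + b *~ n) *~ m' + (y *~ m' + b *~ n') *~ m.
  rewrite PoszM !mulrzDl !mulrzDr -!mulrzA !mulrzz addrACA.
  by rewrite [in (y *~ _)](mulrC m%:Z).
have p : 0 < m%:R :> R by rewrite ltr0n.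
have p' : 0 < m'%:R :> R by rewrite ltr0n.
apply: (le_trans (nuD _ _)); rewrite !nuM natrM !ger0_norm// -!pmulrn.
have := ler_wpM2r (ltW p') (ltW h); have := ler_wpM2r (ltW p) (ltW h').
nra.
Qed.

Lemma quot_seminorm0 : quot_seminorm 0 = 0.
Proof.
apply/eqP; rewrite eq_le quot_seminorm_ge0 andbT.
by rewrite -[leRHS]seminorm0 -[X in nu X](addr0 0) -[X in _ + X](mulr0z b) quot_seminorm_le1.
Qed.

Lemma quot_seminormN x : quot_seminorm (- x) = quot_seminorm x.
Proof.
suff h y : quot_seminorm (- y) <= quot_seminorm y.
  by apply/eqP; rewrite eq_le h /= -[in leLHS](opprK x) h.
apply: le_quot_seminorm => m n m0.
rewrite -ler_pdivlMr ?ltr0n// -seminormN opprD -mulNrz -mulrNz.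
exact: quot_seminorm_le.
Qed.

Lemma quot_seminormMn x (k : nat) :
  quot_seminorm (x *~ k) = k%:R * quot_seminorm x.
Proof.
case: k => [|k]; first by rewrite mulr0z quot_seminorm0 mul0r.
have k0 : 0 < k.+1%:R :> R by rewrite ltr0n.
apply/eqP; rewrite eq_le; apply/andP; split.
  rewrite mulrC -ler_pdivrMr//; apply: le_quot_seminorm => m n m0.
  rewrite -(ler_pM2l k0) mulrA mulrCA divff ?gt_eqF// mulr1.
  have h : nu (x *~ k.+1 *~ m + b *~ (n * k.+1)) = k.+1%:R * nu (x *~ m + b *~ n).
    rewrite -[_%:R in RHS]/(`|k.+1%:Z|%:~R) -nuM mulrzDl -!mulrzA.
    by rewrite (mulrC k.+1%:Z).
  by rewrite -h -ler_pdivlMr ?ltr0n// quot_seminorm_le.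
apply: le_quot_seminorm => m n m0.
have km0 : (0 < k.+1 * m)%N by rewrite muln_gt0.
have := quot_seminorm_le x n km0; rewrite ler_pdivlMr ?ltr0n// natrM PoszM mulrzA.
by rewrite mulrA [_ * k.+1%:R]mulrC.
Qed.

Lemma quot_seminormM x (k : int) :
  quot_seminorm (x *~ k) = `|k|%:~R * quot_seminorm x.
Proof.
case: k => k; first exact: quot_seminormMn.
by rewrite NegzE mulrNz quot_seminormN quot_seminormMn normrN.
Qed.

Lemma quot_seminorm_shift x n : quot_seminorm (x + b *~ n) = quot_seminorm x.
Proof.
have hb k : quot_seminorm (b *~ k) = 0.
  apply/eqP; rewrite eq_le quot_seminorm_ge0 andbT -(seminorm0).
  by rewrite -[X in nu X](addrN (b *~ k)) -mulrNz quot_seminorm_le1.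
apply/eqP; rewrite eq_le; apply/andP; split.
  by rewrite (le_trans (quot_seminormD _ _))// hb addr0.
rewrite -{1}(addrK (b *~ n) x) -mulrNz.
by rewrite (le_trans (quot_seminormD _ _))// hb addr0.
Qed.

(** A nearly optimal rational multiple [n / m] of [b] is rounded to the nearest integer; the
    rounding error is at most one half and costs [nu b / 2]. *)
Lemma quot_seminorm_lift x (e : R) : 0 < e ->
  exists n, nu (x + b *~ n) <= quot_seminorm x + nu b / 2 + e.
Proof.
move=> e0; have [m [n [m0 h]]] := quot_seminorm_near x e0.
have [t ht] : exists t : int, `|t * m - n| * 2 <= m%:Z.
  (* This is the floor of [n / m + 1/2]. *)
  exists (divz (n * 2 + m%:Z) (m%:Z * 2)).
  have := divz_eq (n * 2 + m%:Z) (m%:Z * 2); set t := divz _ _.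
  have : (0 <= modz (n * 2 + m%:Z) (m%:Z * 2) < m%:Z * 2).
    by rewrite modz_ge0 ?ltz_pmod//; lia.
  by move: (modz _ _) => s; lia.
exists t.
have p : 0 < m%:R :> R by rewrite ltr0n.
rewrite -(ler_pM2r p).
have -> : nu (x + b *~ t) * m%:R = nu ((x *~ m + b *~ n) + b *~ (t * m - n)).
  rewrite -addrA -mulrzDr addrCA subrr addr0 mulrzA -mulrzDl nuM.
  by rewrite ger0_norm// -pmulrn mulrC.
apply: (le_trans (nuD _ _)); rewrite nuM.
have : `|t * m - n|%:~R * 2 <= m%:R :> R.
  by rewrite -(ler_int R) in ht; rewrite rmorphM /= in ht.
have := seminorm_ge0 b; nra.
Qed.

End Seminorm.

Section ReducedGenerators.
Variables (R : realType) (V : zmodType) (K : set V).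
Hypothesis K0 : K 0.
Hypothesis KB : forall x y, K x -> K y -> K (x - y).

Lemma subgroup_opp x : K x -> K (- x).
Proof. by rewrite -sub0r; apply: KB. Qed.

Lemma subgroup_add x y : K x -> K y -> K (x + y).
Proof. by move=> hx hy; rewrite -(opprK y); apply/KB/subgroup_opp. Qed.

Lemma subgroup_mulz x (n : int) : K x -> K (x *~ n).
Proof.
move=> hx; have h m : K (x *~ Posz m).
  elim: m => [|m IH]; first by rewrite mulr0z.
  by rewrite -addn1 PoszD mulrzDr; apply: subgroup_add.
by case: n => n //; rewrite NegzE mulrNz; apply/subgroup_opp.
Qed.

Lemma subgroup_sum (I : Type) (s : seq I) (P : pred I) (F : I -> V) :
  (forall i, K (F i)) -> K (\sum_(i <- s | P i) F i).
Proof. by move=> h; apply: (big_ind K) => //; exact: subgroup_add. Qed.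

(* [b 0] is a nearly shortest vector, and the remaining generators come from the
   seminorm induced on the quotient by [b 0]. A vector of positive quotient
   seminorm lifts, by rounding the multiple of [b 0], to one that is at most 6
   times longer, because half of [nu (b 0)] is absorbed by near-minimality. *)
Lemma reduced_generators r (nu : V -> R) (e : R) :
  (forall x y, nu (x + y) <= nu x + nu y) ->
  (forall x (m : int), nu (x *~ m) = `|m|%:~R * nu x) ->
  0 < e -> (forall x, K x -> nu x < e -> nu x = 0) ->
  (forall x : 'I_r.+1 -> V, (forall i, K (x i)) ->
     exists2 c : 'I_r.+1 -> int, exists i, c i != 0 & nu (\sum_i x i *~ c i) = 0) ->
  exists (b : 'I_r -> V) (q : 'I_r -> V -> int), [/\ forall i, K (b i),
    forall i x y, K x -> K y -> q i (x + y) = q i x + q i y,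
    forall x, K x -> nu (x - \sum_i b i *~ q i x) = 0 &
    forall x, K x -> \sum_i `|q i x|%:~R * nu (b i) <= 13 ^+ r * nu x].
Proof.
elim: r nu e => [|r IH] nu e nuD nuM e0 disc dep.
  exists (fun _ => 0), (fun _ _ => 0); split => //.
  - move=> x hx; rewrite big_ord0 subr0.
    have [c [i ci]] := dep (fun _ => x) (fun _ => hx).
    rewrite big_ord1 nuM => /eqP; rewrite (ord1 i) in ci.
    by rewrite mulf_eq0 intr_eq0 normr_eq0 (negbTE ci) => /eqP.
  - by move=> x hx; rewrite big_ord0 expr0 mul1r (seminorm_ge0 nuD nuM).
have nu_ge0 := seminorm_ge0 nuD nuM.
have [nu0|] := pselect (forall x, K x -> nu x = 0).
  exists (fun _ => 0), (fun _ _ => 0); split => // x hx.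
    by rewrite big1 ?subr0 ?nu0// => i _; rewrite mulr0z.
  by rewrite big1 ?nu0 ?mulr0// => i _; rewrite normr0 mul0r.
move=> /existsNP [b1 /not_implyP [Kb1 nub1]].
(* The infimum of the nonzero values of [nu] on [K] is at least [e], hence positive, and [b] is
   taken within a factor 3/2 of it. *)
have [b [Kb b0 hb]] : exists b, [/\ K b, 0 < nu b &
    forall x, K x -> nu x < 2 / 3 * nu b -> nu x = 0].
  pose A := [set nu x | x in [set x | K x /\ nu x != 0]].
  have A1 : A (nu b1) by exists b1 => //; split => //; exact/eqP.
  have Ae : lbound A e.
    move=> _ [x [Kx xn] <-]; rewrite leNgt; apply/negP => h.
    by rewrite disc ?eqxx in xn.
  have iA : e <= inf A by apply: lb_le_inf => //; exists (nu b1).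
  have [_ [b [Kb bn] <-] hb] : exists2 y, A y & y < inf A + inf A / 2.
    by apply: inf_adherent; [lra | split; [exists (nu b1) | exists e]].
  exists b; split => //; first by rewrite lt_neqAle eq_sym bn nu_ge0.
  move=> x Kx hx; apply: contrapT => xn.
  have : inf A <= nu x by apply: ge_inf; [exists e | exists x => //; split => //; exact/eqP].
  lra.
pose nu' := quot_seminorm nu b.
have nu'_ge0 : forall x, 0 <= nu' x := quot_seminorm_ge0 nuD nuM b.
(* Since [1/8 + 1/2 + 1/24 = 2/3], the lift falls into the gap below [2/3 * nu b], where only the
   value 0 occurs. *)
have lift1 x : K x -> nu' x < nu b / 8 -> exists n, nu (x + b *~ n) = 0.
  move=> Kx hx; have e1 : 0 < nu b / 24 by lra.
  have [n hn] := quot_seminorm_lift nuD nuM b x e1.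
  exists n; apply: hb; first by apply/subgroup_add/subgroup_mulz.
  by rewrite -/nu' in hn; lra.
(* Beyond the threshold [nu b <= 8 * nu' x], and [1 + 8 * (1/2 + 1/24) = 16/3 <= 6]. *)
have lift2 x : K x -> exists n, nu (x + b *~ n) <= 6 * nu' x.
  move=> Kx; have [h|h] := ltP (nu' x) (nu b / 8).
    by have [n hn] := lift1 x Kx h; exists n; rewrite hn mulr_ge0.
  have e1 : 0 < nu b / 24 by lra.
  have [n hn] := quot_seminorm_lift nuD nuM b x e1.
  by exists n; rewrite -/nu' in hn; lra.
have shift x n : nu' (x + b *~ n) = nu' x := quot_seminorm_shift nuD nuM b x n.
have nu'0 x : nu x = 0 -> nu' x = 0.
  move=> h; apply/eqP; rewrite eq_le nu'_ge0 andbT -h.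
  by rewrite -{2}(addr0 x) -(mulr0z b) (quot_seminorm_le1 nuD nuM).
have [|||||b' [q [Kb' qD qE qle]]] := IH nu' (nu b / 8).
- exact: quot_seminormD.
- exact: quot_seminormM.
- by lra.
- move=> x Kx /(lift1 _ Kx) [n hn]; rewrite -(shift x n); exact: nu'0.
- move=> x Kx.
  (* Prepending [b] gives a family to which [dep] applies. As [nu b > 0], the resulting relation
     cannot involve [b] alone, so it survives in the quotient. *)
  pose x1 i := if unlift ord0 i is Some j then x j else b.
  have [|c [i ci] hc] := dep x1.
    by move=> i; rewrite /x1; case: unliftP => [j|] _.
  rewrite big_ord_recl /x1 unlift_none in hc.
  have {}hc : nu (b *~ c ord0 + \sum_j x j *~ c (lift ord0 j)) = 0.
    by rewrite -[RHS]hc; congr (nu (_ + _)); apply: eq_bigr => j _; rewrite liftK.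
  exists (fun j => c (lift ord0 j)); last first.
    by rewrite -(shift _ (c ord0)) addrC; apply: nu'0.
  apply: contrapT => hn.
  have c0 j : c (lift ord0 j) = 0.
    by apply: contrapT => /eqP h; apply: hn; exists j.
  rewrite big1 ?addr0 in hc; last by move=> j _; rewrite c0 mulr0z.
  move: hc; rewrite nuM => /eqP; rewrite mulf_eq0 intr_eq0 normr_eq0.
  rewrite (gt_eqF b0) orbF; move: ci.
  by case: (unliftP ord0 i) => [j ->|->]; rewrite ?c0 ?eqxx// => /negPf ->.
have [t ht] := choice (fun i => lift2 (b' i) (Kb' i)).
pose b2 i := b' i + b *~ t i.
have Kb2 i : K (b2 i) by apply/subgroup_add/subgroup_mulz.
have hy x : K x -> nu' (x - \sum_i b2 i *~ q i x) = 0.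
  move=> Kx; rewrite -(qE x Kx) -(shift _ (\sum_i t i * q i x)).
  congr nu'; rewrite mulrz_sumr -addrA; congr (_ + _).
  rewrite -[LHS]opprK; congr (- _); rewrite opprD opprK -sumrB.
  by apply: eq_bigr => i _; rewrite mulrzDl mulrzA addrK.
have /choice [q0 hq0] : forall x, exists n, K x ->
    nu (x - \sum_i b2 i *~ q i x - b *~ n) = 0.
  move=> x.
  have [Kx|] := pselect (K x); last by exists 0.
  have [|n hn] := lift2 (x - \sum_i b2 i *~ q i x).
    by apply/KB/subgroup_sum => // i; exact: subgroup_mulz.
  exists (- n) => _; apply/eqP; rewrite mulrNz opprK eq_le nu_ge0 andbT.
  by rewrite (le_trans hn)// hy// mulr0.
pose bb i := if unlift ord0 i is Some j then b2 j else b.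
pose qq i := if unlift ord0 i is Some j then q j else q0.
have bb0 : bb ord0 = b by rewrite /bb unlift_none.
have bbS i : bb (lift ord0 i) = b2 i by rewrite /bb liftK.
have qq0 : qq ord0 = q0 by rewrite /qq unlift_none.
have qqS i : qq (lift ord0 i) = q i by rewrite /qq liftK.
exists bb, qq; split.
- by move=> i; rewrite /bb; case: unliftP.
- move=> i x y Kx Ky; case: (unliftP ord0 i) => [j ->|->].
    by rewrite !qqS; exact: qD.
  rewrite qq0.
  have Kxy := subgroup_add Kx Ky.
  pose g x := x - \sum_i b2 i *~ q i x.
  have gD : g (x + y) = g x + g y.
    rewrite /g addrACA -opprD -big_split /=; congr (_ - _).
    by apply: eq_bigr => j _; rewrite qD// mulrzDr.
  (* The values of [q0] were chosen point by point; they are additive because the defect times [b]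
     is null while [nu b > 0]. *)
  have : nu (b *~ (q0 x + q0 y - q0 (x + y))) = 0.
    have -> : b *~ (q0 x + q0 y - q0 (x + y)) = (g (x + y) - b *~ q0 (x + y)) +
       (- (g x - b *~ q0 x) - (g y - b *~ q0 y)).
      rewrite gD mulrzBr mulrzDr -opprD (addrACA (g x)) -(opprD (b *~ _)) opprB.
      by rewrite [RHS]addrC addrA subrK.
    apply/eqP; rewrite eq_le nu_ge0 andbT (le_trans (nuD _ _))// hq0// add0r.
    by rewrite (le_trans (nuD _ _))// !(seminormN nuM) !hq0// addr0.
  rewrite nuM => /eqP; rewrite mulf_eq0 intr_eq0 normr_eq0 (gt_eqF b0) orbF.
  by move=> /eqP; lia.
- move=> x Kx; rewrite big_ord_recl bb0 qq0 opprD addrCA addrC.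
  under eq_bigr do rewrite bbS qqS.
  exact: hq0.
- move=> x Kx; rewrite big_ord_recl bb0 qq0.
  under eq_bigr do rewrite bbS qqS.
  have h1 : \sum_i `|q i x|%:~R * nu (b2 i) <= 6 * (13 ^+ r * nu x).
    have : \sum_i `|q i x|%:~R * nu (b2 i) <= 6 * \sum_i `|q i x|%:~R * nu' (b' i).
      rewrite mulr_sumr; apply: ler_sum => i _.
      by rewrite mulrCA ler_wpM2l// ?ler0z//; exact: ht.
    move=> h; apply: (le_trans h); rewrite ler_pM2l//; apply: (le_trans (qle x Kx)).
    rewrite ler_pM2l ?exprn_gt0// /nu' -{2}(addr0 x) -(mulr0z b).
    exact: quot_seminorm_le1.
  have h2 : `|q0 x|%:~R * nu b <= nu x + \sum_i `|q i x|%:~R * nu (b2 i).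
    rewrite -nuM -[b *~ _](subrK (x - \sum_i b2 i *~ q i x)).
    apply: (le_trans (nuD _ _)); rewrite -(seminormN nuM) opprB hq0// add0r.
    apply: (le_trans (nuD _ _)); rewrite (seminormN nuM) lerD2l.
    elim/big_ind2: _ => [|u v w z h h'|i _].
    + by rewrite (seminorm0 nuM).
    + by rewrite (le_trans (nuD _ _))// lerD.
    + by rewrite nuM.
  (* The two bounds add up to [nu x + 2 * 6 * 13 ^ r * nu x], which is at most
     [13 ^ (r + 1) * nu x]. *)
  have : nu x <= 13 ^+ r * nu x.
    by rewrite ler_peMl// exprn_ege1// ler1n.
  by rewrite exprS; lra.
Qed.

End ReducedGenerators.

(** * Ranks of integer families *)

Lemma ffunMzE (I : finType) (V : zmodType) (g : {ffun I -> V}) (n : int) x :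
  (g *~ n) x = g x *~ n.
Proof.
case: n => n; first by rewrite -pmulrn ffunMnE.
by rewrite NegzE !mulrNz ffunE -pmulrn ffunMnE.
Qed.

Section IntegerRank.
Variable I : finType.
Implicit Types (k : nat).

Definition family_mx k (S : 'I_k -> {ffun I -> int}) : 'M[rat]_(k, #|I|) :=
  \matrix_(i, j) (S i (enum_val j))%:~R.

Lemma row_family_mx k (S : 'I_k -> {ffun I -> int}) (c : 'I_k -> int) :
  (\row_i (c i)%:~R) *m family_mx S =
  \row_j ((\sum_i S i *~ c i) (enum_val j))%:~R.
Proof.
apply/rowP => j; rewrite !mxE sum_ffunE rmorph_sum /=.
apply: eq_bigr => i _; rewrite !mxE.
by rewrite ffunMzE mulrzz rmorphM /= mulrC.
Qed.

Lemma zindep_free k (S : 'I_k -> {ffun I -> int}) :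
  row_free (family_mx S) -> zindep S.
Proof.
move=> free c hc i; apply/eqP.
have : (\row_i (c i)%:~R) *m family_mx S = 0.
  by rewrite row_family_mx hc; apply/rowP => j; rewrite !mxE ffunE.
move/eqP; rewrite mulmx_free_eq0// => /eqP /rowP /(_ i).
by rewrite !mxE => /eqP; rewrite intr_eq0.
Qed.

(** A rational relation becomes an integral one after multiplication by the product of its
    denominators. *)
Lemma free_zindep k (S : 'I_k -> {ffun I -> int}) :
  zindep S -> row_free (family_mx S).
Proof.
move=> ind; rewrite -kermx_eq0; apply/rowV0P => u /sub_kermxP hu.
pose d := \prod_j denq (u 0 j).
pose c i := numq (u 0 i) * \prod_(j | j != i) denq (u 0 j).
have cE i : (c i)%:~R = d%:~R * u 0 i.
  rewrite /d (bigD1 i)//= [in LHS]/c !rmorphM /= mulrAC; congr (_ * _).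
  by rewrite mulrC numqE.
have d0 : d != 0 by apply/prodf_neq0 => i _; exact: denq_neq0.
suff c0 i : c i = 0.
  apply/rowP => i; have := cE i; rewrite c0 mxE => /esym/eqP.
  by rewrite mulf_eq0 intr_eq0 (negbTE d0) => /eqP.
apply: ind i; apply/ffunP => x; rewrite [RHS]ffunE; apply/eqP.
have : (\row_i (c i)%:~R) *m family_mx S = 0.
  have -> : \row_i (c i)%:~R = d%:~R *: u.
    by apply/rowP => j; rewrite !mxE cE.
  by rewrite -scalemxAl hu scaler0.
rewrite row_family_mx => /rowP /(_ (enum_rank x)).
by rewrite !mxE enum_rankK => /eqP; rewrite intr_eq0.
Qed.

Lemma zindep_size k (S : 'I_k -> {ffun I -> int}) : zindep S -> (k <= #|I|)%N.
Proof. by move=> /free_zindep /eqP <-; exact: rank_leq_col. Qed.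

Lemma zindep_inj k l (S : 'I_l -> {ffun I -> int}) (f : 'I_k -> 'I_l) :
  injective f -> zindep S -> zindep (S \o f).
Proof.
move=> fI ind c hc j.
have := ind (fun i => \sum_(j | f j == i) c j) _ (f j).
rewrite (eq_bigl (pred1 j)) ?big_pred1_eq => [->//|j' /=]; last first.
  exact: (inj_eq fI).
rewrite -[RHS]hc [RHS](partition_big f xpredT)//=.
apply: eq_bigr => i _; rewrite mulrz_sumr /=.
by apply: eq_bigr => j' /eqP <-.
Qed.

(** Steinitz exchange over the rationals: the rows of [Z], scaled by [d], lie in the row space of
    [W], so [W] has rank at least [k] and contains [k] independent rows. *)
Lemma zindep_exchange k (J : finType) (Z : 'I_k -> {ffun I -> int})
    (W : J -> {ffun I -> int}) (a : 'I_k -> J -> int) (d : int) :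
  d != 0 -> zindep Z -> (forall i, Z i *~ d = \sum_j W j *~ a i j) ->
  exists f : 'I_k -> J, zindep (W \o f).
Proof.
move=> d0 indZ hZ.
pose W' (i : 'I_#|J|) := W (enum_val i).
have hk : (k <= \rank (family_mx W'))%N.
  have -> : k = \rank (d%:~R *: family_mx Z).
    by rewrite mxrank_scale_nz ?intr_eq0//; apply/esym/eqP/free_zindep.
  pose a' i (j : 'I_#|J|) := a i (enum_val j).
  pose A : 'M[rat]_(k, #|J|) := \matrix_(i, j) (a' i j)%:~R.
  have -> : d%:~R *: family_mx Z = A *m family_mx W'.
    apply/row_matrixP => i; rewrite row_mul.
    have -> : row i A = \row_j (a' i j)%:~R by apply/rowP => j; rewrite !mxE.
    rewrite row_family_mx; apply/rowP => j; rewrite !mxE.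
    have -> : \sum_j W' j *~ a' i j = Z i *~ d.
      rewrite hZ (reindex (@enum_val J xpredT))//=.
      by apply: onW_bij; exact: enum_val_bij.
    by rewrite ffunMzE mulrzz rmorphM /= mulrC.
  exact: mxrankM_maxr.
pose g i := maxrankfun (family_mx W') (widen_ord hk i).
exists (enum_val \o g).
have : zindep (W' \o maxrankfun (family_mx W')).
  apply: zindep_free.
  have -> : family_mx (W' \o maxrankfun (family_mx W')) =
      rowsub (maxrankfun (family_mx W')) (family_mx W').
    by apply/matrixP => i j; rewrite !mxE.
  exact: maxrowsub_free.
apply: zindep_inj => i j /(congr1 val) /= h; exact: val_inj.
Qed.

End IntegerRank.

Section ZRank.
Variable I : finType.

Lemma zdependent k (S : 'I_k -> {ffun I -> int}) : (#|I| < k)%N ->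
  exists2 c : 'I_k -> int, exists i, c i != 0 & \sum_i S i *~ c i = 0.
Proof.
move=> hk; apply: contrapT => h.
suff /zindep_size : zindep S by rewrite leqNgt hk.
move=> c hc i; apply: contrapT => /eqP ci; apply: h.
by exists c => //; exists i.
Qed.

Lemma zrank_witness (A : set {ffun I -> int}) :
  exists S : 'I_(zrank A) -> {ffun I -> int}, (forall i, A (S i)) /\ zindep S.
Proof.
rewrite /zrank.
case: (@eq_bigmax_cond _ (fun k : 'I_#|I|.+1 => `[< exists S : 'I_k -> {ffun I -> int},
  (forall i, A (S i)) /\ zindep S >]) (fun k => k)).
  apply/card_gt0P; exists ord0; apply/asboolP; exists (fun _ => 0).
  by split; [case | move=> c _ []].
by move=> k /asboolP hk ->.
Qed.

Lemma zrank_ge (A : set {ffun I -> int}) k (S : 'I_k -> {ffun I -> int}) :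
  (forall i, A (S i)) -> zindep S -> (k <= zrank A)%N.
Proof.
move=> hS ind; have hk := zindep_size ind.
apply: (@leq_bigmax_cond _ (fun k : 'I_#|I|.+1 => `[< exists S : 'I_k -> {ffun I -> int},
  (forall i, A (S i)) /\ zindep S >]) (fun k => k) (Ordinal (hk : k < #|I|.+1)%N)).
by apply/asboolP; exists S.
Qed.

Lemma zrank_span k (S : 'I_k -> {ffun I -> int}) : zindep S -> (k <= zrank (zspan S))%N.
Proof.
move=> ind; apply: zrank_ge ind => i; exists (fun j => (j == i)%:R) => //=.
rewrite (bigD1 i)//= eqxx mulr1z big1 ?addr0// => j /negPf ->.
by rewrite mulr0z.
Qed.

End ZRank.

(** * The l1 norm of integer chains *)

Section Norms.
Variable I : finType.
Implicit Types a b : {ffun I -> int}.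

Lemma l1D a b : (l1 (a + b)%R <= l1 a + l1 b)%N.
Proof.
have absD (x y : int) : (`|(x + y)%R| <= `|x| + `|y|)%N by lia.
by rewrite /l1 -big_split leq_sum// => i _; rewrite ffunE absD.
Qed.

Lemma l1M a (n : int) : l1 (a *~ n) = (`|n| * l1 a)%N.
Proof.
rewrite /l1 big_distrr; apply: eq_bigr => i _ /=.
by rewrite ffunMzE mulrzz abszM mulnC.
Qed.

Lemma l1_0 : l1 (0 : {ffun I -> int}) = 0%N.
Proof. by rewrite -(mulr0z 0) l1M. Qed.

Lemma l1N a : l1 (- a) = l1 a.
Proof. by rewrite -[in LHS](mulr1z a) -mulrNz l1M mul1n. Qed.

Lemma l1_eq0 a : (l1 a == 0%N) = (a == 0).
Proof.
apply/idP/eqP => [|->]; last by rewrite l1_0.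
rewrite /l1 sum_nat_eq0 => /forallP h; apply/ffunP => i; rewrite ffunE.
by have := h i; rewrite /= absz_eq0 => /eqP.
Qed.

Lemma l1_sum (J : Type) (s : seq J) (P : pred J) (F : J -> {ffun I -> int}) :
  (l1 (\sum_(j <- s | P j) F j)%R <= \sum_(j <- s | P j) l1 (F j))%N.
Proof.
elim/big_ind2: _ => [|m x n y hm hn|//]; first by rewrite l1_0.
by rewrite (leq_trans (l1D _ _))// leq_add.
Qed.

End Norms.

(** * Fillings and bounds for [xi2] and [rho1] *)

Section Chains.
Variables (R : realType) (X : polycomplex).

Lemma bd2D (A B : {ffun face X -> int}) : bd2 (A + B) = bd2 A + bd2 B.
Proof.
by rewrite /bd2 -big_split; apply: eq_bigr => f _; rewrite ffunE mulrzDr.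
Qed.

Lemma bd2M (A : {ffun face X -> int}) n : bd2 (A *~ n) = bd2 A *~ n.
Proof.
rewrite /bd2 mulrz_suml; apply: eq_bigr => f _.
by rewrite ffunMzE mulrzz mulrzA.
Qed.

Lemma bd2_0 : bd2 (0 : {ffun face X -> int}) = 0.
Proof. by rewrite -(mulr0z 0) bd2M mulr0z. Qed.

Lemma bd2N (A : {ffun face X -> int}) : bd2 (- A) = - bd2 A.
Proof. by rewrite -[in LHS](mulr1z A) -mulrNz bd2M mulrNz. Qed.

Lemma bd2_sum (J : Type) (s : seq J) (P : pred J) (F : J -> {ffun face X -> int}) :
  bd2 (\sum_(j <- s | P j) F j) = \sum_(j <- s | P j) bd2 (F j).
Proof. exact: (big_morph _ bd2D bd2_0). Qed.

Definition single_face (f : face X) : {ffun face X -> int} :=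
  [ffun g => (g == f)%:R].

Lemma bd2_single f : bd2 (single_face f) = bd_cell f.
Proof.
rewrite /bd2 (bigD1 f)//= ffunE eqxx mulr1z big1 ?addr0// => g /negPf gf.
by rewrite ffunE gf mulr0z.
Qed.

Lemma l1_single f : l1 (single_face f) = 1%N.
Proof.
by rewrite /l1 (bigD1 f)//= ffunE eqxx big1// => g /negPf gf; rewrite ffunE gf.
Qed.

Lemma sum_single (z : {ffun face X -> int}) : \sum_f single_face f *~ z f = z.
Proof.
apply/ffunP => g; rewrite sum_ffunE (bigD1 g)//= ffunMzE ffunE eqxx mulrzz mul1r.
rewrite big1 ?addr0// => f /negPf fg.
by rewrite ffunMzE ffunE eq_sym fg mul0rz.
Qed.

(** Exchange extracts from the cycles [W f] an independent family of the full rank of [H2], which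
    competes in the infimum defining [xi2]. *)
Lemma xi2_le (W : face X -> {ffun face X -> int}) (d : int) (B : R) :
  d != 0 -> 0 <= B ->
  (forall f, bd2 (W f) = 0) -> (forall f, (l1 (W f))%:R <= B) ->
  (forall z, bd2 z = 0 -> z *~ d = \sum_f W f *~ z f) ->
  xi2 R X <= B.
Proof.
move=> d0 B0 cyc hB span; rewrite /xi2; case: eqP => [//|_].
have [Z [ZH indZ]] := zrank_witness (H2 (X := X)).
have [f indW] := zindep_exchange d0 indZ (fun i => span _ (ZH i)).
apply: (@le_trans _ _ (\max_(j < zrank (H2 (X := X))) l1 ((W \o f) j))%:R).
  apply: ge_inf; first by exists 0 => _ [S _ <-].
  exists (W \o f) => //; split => [j|]; first exact: cyc.
  apply/eqP; rewrite eqn_leq zrank_span// andbT.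
  (* The span consists of cycles, so its rank cannot exceed that of [H2]. *)
  have [S [hS indS]] := zrank_witness (zspan (W \o f)).
  apply: zrank_ge indS => i; have [c _ <-] := hS i.
  rewrite /H2 /= bd2_sum big1// => j _.
  by rewrite bd2M /= cyc mul0rz.
elim/big_ind: _ => [//|m n hm hn|j _]; last exact: hB.
by rewrite /maxn; case: ifP.
Qed.

(** Norms of integer chains are natural numbers, so the infimum in [fill1] is attained. *)
Lemma fill_le (rho : R) z : 0 < rho -> (rho%:E <= rho1 R X)%E -> range (@bd2 X) z ->
  exists2 A : {ffun face X -> int}, bd2 A = z & (l1 A)%:R * rho <= (l1 z)%:R.
Proof.
move=> rho0 hrho [A0 _ hA0].
have [z0|z0] := eqVneq z 0.
  by exists 0; rewrite ?bd2_0 ?z0// !l1_0 mul0r.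
have ex : exists n, `[< exists2 A : {ffun face X -> int}, bd2 A = z & l1 A = n >].
  by exists (l1 A0); apply/asboolP; exists A0.
case: (ex_minnP ex) => n /asboolP [A hA An] hmin.
exists A => //.
have hfill : (l1 A)%:R <= fill1 R z.
  apply: lb_le_inf; first by exists (l1 A)%:R; exists A.
  move=> _ [B /= hB <-]; rewrite ler_nat An; apply: hmin.
  by apply/asboolP; exists B.
have A0' : (0 < l1 A)%N.
  rewrite lt0n l1_eq0; apply: contra_neq z0 => h.
  by rewrite -hA h bd2_0.
have f0 : 0 < fill1 R z by apply: lt_le_trans hfill; rewrite ltr0n.
have : (rho%:E <= ((l1 z)%:R / fill1 R z)%:E)%E.
  apply: le_trans hrho _; apply: ereal_inf_lbound; exists z => //.
  by split => //; exists A0.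
rewrite lee_fin ler_pdivlMr// => h; apply: le_trans h.
by rewrite mulrC ler_pM2l.
Qed.

(** Any filling of a nonzero [z] is a nonzero integer chain, hence [fill1 z >= 1]. *)
Lemma rho1_le (z : {ffun edge X -> int}) : z != 0 -> range (@bd2 X) z ->
  (rho1 R X <= (l1 z)%:R%:E)%E.
Proof.
move=> z0 [A0 _ hA0].
apply: (@le_trans _ _ ((l1 z)%:R / fill1 R z)%:E).
  by apply: ereal_inf_lbound; exists z => //; split => //; exists A0.
rewrite lee_fin.
have hfill : 1 <= fill1 R z.
  apply: lb_le_inf; first by exists (l1 A0)%:R; exists A0.
  move=> _ [B /= hB <-]; rewrite ler1n lt0n l1_eq0.
  by apply: contra_neq z0 => h; rewrite -hB h bd2_0.
by rewrite ler_pdivrMr ?(lt_le_trans _ hfill)// ler_peMr.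
Qed.

Lemma rho1_ge0 : (0 <= rho1 R X)%E.
Proof.
apply: le_ereal_inf_tmp => _ [z [_ [A _ hA]] <-]; rewrite lee_fin divr_ge0//.
by apply: lb_le_inf => [|_ [B _ <-]//]; exists (l1 A)%:R; exists A.
Qed.

End Chains.

(** * Small relations in a finite quotient *)

Section SmallRelations.
Variables (E : finType) (V : zmodType) (B P : set V) (c : E -> V) (N M : nat).
Hypothesis B0 : B 0.
Hypothesis BB : forall x y, B x -> B y -> B (x - y).
Hypothesis P0 : P 0.
Hypothesis PB : forall x y, P x -> P y -> P (x - y).
Hypothesis Pc : forall e, P (c e).
Hypothesis M0 : (0 < M)%N.
Hypothesis finite_index : forall (J : finType) (v : J -> V),
  (forall j, P (v j)) -> (N < #|J|)%N -> exists j j', j <> j' /\ B (v j - v j').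

Let comb r (t : 'I_r -> E) (y : {ffun 'I_r -> 'I_M.+1}) :=
  \sum_i c (t i) *~ (y i : nat).

Let dissociated r (t : 'I_r -> E) :=
  forall y y', B (comb t y - comb t y') -> y = y'.

(** Pigeonhole: more than [N] combinations would contain two that agree modulo [B]. *)
Let dissociated_card r (t : 'I_r -> E) : dissociated t -> (M.+1 ^ r <= N)%N.
Proof.
move=> dis; rewrite leqNgt; apply/negP => h.
have [||y [y' [ne /dis]]] := @finite_index {ffun 'I_r -> 'I_M.+1} (comb t).
- by move=> y; apply: subgroup_sum => // i; exact: subgroup_mulz.
- by rewrite card_ffun !card_ord.
- by [].
Qed.

(* Take a maximal family [t] whose combinations with coefficients in [0 .. M] are
   pairwise distinct modulo [B]; adding [e] to it creates a coincidence. *)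
Lemma small_relations : exists r (t : 'I_r -> E), (M.+1 ^ r <= N)%N /\
  forall e, exists (m : nat) (x : 'I_r -> int), [/\ (0 < m <= M)%N,
    forall i, (`|x i| <= M)%N & B (c e *~ m - \sum_i c (t i) *~ x i)].
Proof.
pose Q r := `[< exists t : 'I_r -> E, dissociated t >].
have exQ : exists r, Q r.
  exists 0%N; apply/asboolP; unshelve eexists; first by case.
  by move=> y y' _; apply/ffunP; case.
have bound r : Q r -> (r <= N)%N.
  move=> /asboolP [t /dissociated_card h]; apply: leq_trans h; exact/ltnW/ltn_expl.
case: (ex_maxnP exQ bound) => r /asboolP [t dis] rmax.
exists r, t; split; first exact: dissociated_card dis.
move=> e; pose t' i := if unlift ord0 i is Some j then t j else e.
have comb' y : comb t' y = c e *~ (y ord0 : nat) + comb t [ffun i => y (lift ord0 i)].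
  rewrite /comb big_ord_recl /t' unlift_none; congr (_ + _).
  by apply: eq_bigr => i _; rewrite liftK ffunE.
have [y [y' [yy' By]]] : exists y y' : {ffun 'I_r.+1 -> 'I_M.+1},
    y ord0 != y' ord0 /\ B (comb t' y - comb t' y').
  (* Otherwise any coincidence for [t'] has equal coefficients at [e], so it is one for [t] and
     hence trivial; then [t'] would be a longer dissociated family. *)
  apply: contrapT => h; suff /rmax : Q r.+1 by rewrite ltnn.
  apply/asboolP; exists t' => y y' By.
  have y0 : y ord0 = y' ord0.
    by apply: contrapT => /eqP ne; apply: h; exists y, y'.
  move: By; rewrite !comb' y0 opprD addrACA subrr add0r => /dis /ffunP yy.
  apply/ffunP => i; case: (unliftP ord0 i) => [j ->|->] //.
  by have := yy j; rewrite !ffunE.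
(* Exchanging [y] and [y'] makes the coefficient of [e] in the difference positive. *)
wlog lt : y y' yy' By / (y' ord0 < y ord0)%N.
  move=> h; case: (ltngtP (y' ord0) (y ord0)) => [lt|lt|eq].
  - exact: (h y y').
  - by apply: (h y' y) => //; rewrite 1?eq_sym// -opprB; exact: subgroup_opp.
  - by case/eqP: yy'; apply: val_inj.
exists (y ord0 - y' ord0)%N, (fun i => (y' (lift ord0 i) : nat)%:Z - (y (lift ord0 i) : nat)%:Z).
split.
- by rewrite subn_gt0 lt (leq_trans (leq_subr _ _))// -ltnS ltn_ord.
- move=> i; have := ltn_ord (y (lift ord0 i)); have := ltn_ord (y' (lift ord0 i)).
  lia.
- move: By; rewrite !comb' opprD addrACA -mulrzBr /comb -sumrB -subzn ?(ltnW lt)//.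
  rewrite -[X in _ - X]opprK opprK -sumrN.
  congr (B (_ + _)); apply: eq_bigr => i _.
  by rewrite !ffunE -mulrzBr -mulrNz opprB.
Qed.

End SmallRelations.

(** * Short 2-cycles *)

Section Core.
Variables (R : realType) (X : polycomplex).
Variables (c : edge X -> {ffun edge X -> int}) (L M kappa r : nat) (rho : R).
Variables (t : 'I_r -> edge X) (m : edge X -> nat) (x : edge X -> 'I_r -> int).
Hypothesis rho0 : 0 < rho.
Hypothesis M0 : (0 < M)%N.
Hypothesis c_bd : forall f, bd_cell f = \sum_e c e *~ bd_cell f e.
Hypothesis c_le : forall e, (l1 (c e) <= L)%N.
Hypothesis kappa_le : forall f : face X, supports_cycle f -> (l1 (bd_cell f) <= kappa)%N.
Hypothesis filling : forall z, range (@bd2 X) z ->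
  exists2 A : {ffun face X -> int}, bd2 A = z & (l1 A)%:R * rho <= (l1 z)%:R.
Hypothesis m_bound : forall e, (0 < m e <= M)%N.
Hypothesis x_bound : forall e i, (`|x e i| <= M)%N.
Hypothesis relation : forall e,
  range (@bd2 X) (c e *~ m e - \sum_i c (t i) *~ x e i).

Let B := range (@bd2 X).

Lemma boundary0 : range (@bd2 X) 0.
Proof. by exists 0 => //; exact: bd2_0. Qed.

Lemma boundaryB z z' :
  range (@bd2 X) z -> range (@bd2 X) z' -> range (@bd2 X) (z - z').
Proof. by move=> [A _ <-] [A' _ <-]; exists (A - A') => //; rewrite bd2D bd2N. Qed.

(** A common multiple of all the [m e], so that one multiplier serves every edge. *)
Let Ee := M`!.
Let y e i : int := x e i * (Ee %/ m e)%N.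
Let Rel e := c e *~ Ee - \sum_i c (t i) *~ y e i.

Let Ee_div e : (m e * (Ee %/ m e) = Ee)%N.
Proof. by rewrite mulnC divnK// dvdn_fact. Qed.

Let B_Rel e : B (Rel e).
Proof.
have -> : Rel e = (c e *~ m e - \sum_i c (t i) *~ x e i) *~ (Ee %/ m e)%N.
  rewrite mulrzBl -mulrzA -PoszM Ee_div mulrz_suml; congr (_ - _).
  by apply: eq_bigr => i _; rewrite mulrzA.
exact: (subgroup_mulz boundary0 boundaryB).
Qed.

Let y_bound e i : (`|y e i| <= Ee * M)%N.
Proof.
rewrite abszM mulnC leq_mul// ?x_bound//.
exact: leq_div.
Qed.

Let l1_comb k (s : 'I_k -> edge X) (u : 'I_k -> int) :
  (l1 (\sum_i c (s i) *~ u i)%R <= L * \sum_i `|u i|)%N.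
Proof.
rewrite big_distrr (leq_trans (l1_sum _ _ _))// leq_sum// => i _.
by rewrite l1M mulnC leq_mul.
Qed.

Let l1_Rel e : (l1 (Rel e) <= L * (Ee * M * r.+1))%N.
Proof.
rewrite (leq_trans (l1D _ _))// l1N l1M mulnS mulnDr leq_add//.
  by rewrite mulnC leq_mul// leq_pmulr.
rewrite (leq_trans (l1_comb _ _))// leq_mul//.
apply: (@leq_trans (\sum_(i < r) Ee * M)%N); first by apply: leq_sum.
by rewrite sum_nat_const card_ord mulnC.
Qed.

Let K : set {ffun 'I_r -> int} := [set u | B (\sum_i c (t i) *~ u i)].

Let K0 : K 0.
Proof. by rewrite /K /= big1; [exact: boundary0|move=> i _; rewrite ffunE mulr0z]. Qed.

Let KB u v : K u -> K v -> K (u - v).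
Proof.
move=> hu hv; have := boundaryB hu hv; rewrite -sumrB /K /=; congr (B _).
by apply: eq_bigr => i _; rewrite !ffunE mulrzBr.
Qed.

(** The coordinates on the [c (t i)] of what is left of [M!] times [bd_cell f] once the boundaries
    [Rel e] are subtracted; both being boundaries, [w f] lies in [K]. *)
Let w f : {ffun 'I_r -> int} := [ffun i => \sum_e y e i * bd_cell f e].

Let w_rel f : \sum_i c (t i) *~ w f i = bd_cell f *~ Ee - \sum_e Rel e *~ bd_cell f e.
Proof.
rewrite {1}(c_bd f) mulrz_suml -sumrB.
transitivity (\sum_i \sum_e c (t i) *~ (y e i * bd_cell f e)).
  by apply: eq_bigr => i _; rewrite ffunE mulrz_sumr.
rewrite exchange_big; apply: eq_bigr => e _.
rewrite mulrzBl mulrzAC subKr mulrz_suml.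
by apply: eq_bigr => i _; rewrite mulrzA.
Qed.

Let K_w f : K (w f).
Proof.
rewrite /K /= w_rel; apply: boundaryB; last first.
  apply: (subgroup_sum boundary0 boundaryB) => e.
  by apply: (subgroup_mulz boundary0 boundaryB); exact: B_Rel.
apply: (subgroup_mulz boundary0 boundaryB); rewrite -bd2_single.
by exists (single_face f).
Qed.

Let l1_w f : (l1 (w f) <= r * (Ee * M * l1 (bd_cell f)))%N.
Proof.
apply: (@leq_trans (\sum_(i < r) Ee * M * l1 (bd_cell f))%N); last first.
  by rewrite sum_nat_const card_ord.
apply: leq_sum => i _; rewrite ffunE /l1 big_distrr.
elim/big_ind2: _ => [//|a b a' b' h h'|e _].
  have := leq_add h h'; apply: leq_trans.
  by move: a a' {h h'} => a a'; lia.
by rewrite abszM leq_mul.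
Qed.

(** To each cell [f] corresponds a cycle made of [M!] copies of [f], corrected by fillings of the
    [Rel e] and of the reduced generators of [K]. The copies of [f] account for the subtracted [M!],
    the fillings for the right-hand side. *)
Lemma xi2_core :
  (xi2 R X - Ee%:R) * rho <= (kappa * L * (Ee * M) * (3 * 26 ^ r))%:R.
Proof.
pose nu (u : {ffun 'I_r -> int}) : R := (l1 u)%:R.
(* The norm takes natural values, so 1 is a valid gap, and any [r + 1] vectors of Z^r are
   dependent. *)
have [|||||b [q [Kb qD qE qle]]] := @reduced_generators R _ K K0 KB r nu 1.
- by move=> u v; rewrite /nu -natrD ler_nat l1D.
- by move=> u n; rewrite /nu l1M natrM -abszE -pmulrn.
- by [].
- by move=> u _; rewrite /nu ltrn1 ltnS leqn0 => /eqP ->.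
- move=> u _; have [|d dn hd] := @zdependent 'I_r r.+1 u; first by rewrite card_ord.
  by exists d => //; rewrite hd /nu l1_0.
have q0 i : q i 0 = 0 by have := qD i 0 0 K0 K0; rewrite addr0; lia.
have qN i u : K u -> q i (- u) = - q i u.
  move=> Ku; have := qD i u (- u) Ku (subgroup_opp K0 KB Ku).
  by rewrite subrr q0; lia.
have qM i u n : K u -> q i (u *~ n) = q i u * n.
  move=> Ku; have h k : q i (u *~ Posz k) = q i u * k.
    elim: k => [|k IH]; first by rewrite mulr0z q0 mulr0.
    rewrite -addn1 PoszD mulrzDr qD//; last exact: (subgroup_mulz K0 KB).
    by rewrite IH mulr1z mulrDr mulr1.
  case: n => n; rewrite ?h// NegzE mulrNz qN ?h ?mulrN//.
  exact: (subgroup_mulz K0 KB).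
have qS i (J : finType) (F : J -> {ffun 'I_r -> int}) :
    (forall j, K (F j)) -> q i (\sum_j F j) = \sum_j q i (F j).
  move=> KF; suff [] : K (\sum_j F j) /\ q i (\sum_j F j) = \sum_j q i (F j) by [].
  elim/big_ind2: _ => [//|a1 b1 a2 b2 [h1 e1] [h2 e2]|//].
  by split; [exact: (subgroup_add K0 KB)|rewrite qD// e1 e2].
have bE u : K u -> u = \sum_i b i *~ q i u.
  by move=> /qE /eqP; rewrite pnatr_eq0 l1_eq0 subr_eq0 => /eqP.
have /choice [A /all_and2 [hA Ale]] : forall e, exists A : {ffun face X -> int},
    bd2 A = Rel e /\ (l1 A)%:R * rho <= (l1 (Rel e))%:R.
  by move=> e; have [A ? ?] := filling (B_Rel e); exists A.
have /choice [D /all_and2 [hD Dle]] : forall i, exists A : {ffun face X -> int},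
    bd2 A = \sum_j c (t j) *~ b i j /\
    (l1 A)%:R * rho <= (l1 (\sum_j c (t j) *~ b i j))%:R.
  by move=> i; have [A0 ? ?] := filling (Kb i); exists A0.
(* A cycle [z] kills both sums, because [\sum_f z f * bd_cell f e = 0]; hence
   the [W0 f] span [M!] times the 2-cycles. *)
pose W0 f := single_face f *~ Ee - \sum_e A e *~ bd_cell f e - \sum_i D i *~ q i (w f).
(* Only cells in the support of a cycle have boundaries controlled by [kappa]. Every cycle has
   coefficient 0 on the others, so the value 0 there does not affect the span. *)
pose W f := if supports_cycle f then W0 f else 0.
have Ee0 : Ee%:Z != 0 by rewrite eqz_nat -lt0n fact_gt0.
pose C0 := (kappa * L * (Ee * M) * (3 * 26 ^ r))%N.
suff : xi2 R X <= Ee%:R + C0%:R / rho by rewrite -ler_pdivlMr// lerBlDl.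
apply: (xi2_le (W := W) Ee0).
- by rewrite addr_ge0// divr_ge0// ltW.
- move=> f; rewrite /W; case: ifP => _; last exact: bd2_0.
  rewrite !bd2D !bd2N bd2M bd2_single !bd2_sum.
  have -> : \sum_e bd2 (A e *~ bd_cell f e) = \sum_e Rel e *~ bd_cell f e.
    by apply: eq_bigr => e _; rewrite bd2M hA.
  rewrite -w_rel {1}(bE _ (K_w f)); apply/eqP; rewrite subr_eq0; apply/eqP.
  transitivity (\sum_j \sum_i c (t j) *~ (b i j * q i (w f))).
    apply: eq_bigr => j _; rewrite sum_ffunE mulrz_sumr.
    by apply: eq_bigr => i _; rewrite ffunMzE mulrzz.
  rewrite exchange_big; apply: eq_bigr => i _; rewrite bd2M hD mulrz_suml.
  by apply: eq_bigr => j _; rewrite mulrzA.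
- move=> f; rewrite /W; case: ifP => [/kappa_le fk|_]; last first.
    by rewrite l1_0 addr_ge0// divr_ge0// ltW.
  rewrite -(ler_pM2r rho0) mulrDl divfK ?gt_eqF//.
  have h0 : (l1 (W0 f) <= Ee + \sum_e `|bd_cell f e| * l1 (A e) +
                \sum_i `|q i (w f)| * l1 (D i))%N.
    rewrite (leq_trans (l1D _ _))// l1N leq_add//; last first.
      by rewrite (leq_trans (l1_sum _ _ _))// leq_sum// => i _; rewrite l1M.
    rewrite (leq_trans (l1D _ _))// l1N leq_add//; last first.
      by rewrite (leq_trans (l1_sum _ _ _))// leq_sum// => i _; rewrite l1M.
    by rewrite l1M l1_single muln1.
  have h1 : (\sum_e `|bd_cell f e| * l1 (A e))%:R * rho <= (kappa * (L * (Ee * M * r.+1)))%:R.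
    rewrite natr_sum mulr_suml.
    apply: (@le_trans _ _ (\sum_e (`|bd_cell f e| * (L * (Ee * M * r.+1)))%:R)).
      apply: ler_sum => e _; rewrite !natrM -mulrA ler_wpM2l// -!natrM.
      by apply: (le_trans (Ale e)); rewrite ler_nat l1_Rel.
    by rewrite -natr_sum -big_distrl ler_nat leq_mul.
  have h2 : (\sum_i `|q i (w f)| * l1 (D i))%:R * rho <=
      L%:R * (13 ^ r * (r * (Ee * M * kappa)))%:R.
    rewrite natr_sum mulr_suml.
    apply: (@le_trans _ _ (\sum_i L%:R * (`|q i (w f)|%:~R * nu (b i)))).
      apply: ler_sum => i _; rewrite natrM -mulrA [leRHS]mulrCA -abszE -pmulrn ler_wpM2l//.
      by apply: (le_trans (Dle i)); rewrite /nu -natrM ler_nat l1_comb.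
    rewrite -mulr_sumr ler_wpM2l//; apply: (le_trans (qle _ (K_w f))).
    rewrite natrM natrX ler_wpM2l ?exprn_ge0// ler_nat.
    by rewrite (leq_trans (l1_w f))// !leq_mul.
  (* The two kinds of fillings contribute the factors [r + 1] and [r * 13 ^ r]; as [r < 2 ^ r],
     their sum is at most [3 * 26 ^ r]. *)
  have h3 : (kappa * (L * (Ee * M * r.+1)) + L * (13 ^ r * (r * (Ee * M * kappa))) <= C0)%N.
    have r2 : (r < 2 ^ r)%N by exact: ltn_expl.
    have e26 : (26 ^ r = 2 ^ r * 13 ^ r)%N by rewrite -expnMn.
    have e13 : (0 < 13 ^ r)%N by rewrite expn_gt0.
    rewrite /C0 e26; move: (2 ^ r)%N (13 ^ r)%N r2 e13 => a d ha hd.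
    have : (r.+1 + d * r <= 3 * (a * d))%N by nia.
    move: (Ee * M)%N => z hz; have := leq_mul (leqnn (kappa * L * z)%N) hz; lia.
  have h0' : (l1 (W0 f))%:R * rho <= (Ee%:R + (\sum_e `|bd_cell f e| * l1 (A e))%:R +
                (\sum_i `|q i (w f)| * l1 (D i))%:R) * rho.
    by rewrite ler_pM2r// -!natrD ler_nat.
  have h3' : (kappa * (L * (Ee * M * r.+1)))%:R +
      L%:R * (13 ^ r * (r * (Ee * M * kappa)))%:R <= C0%:R :> R.
    by rewrite -natrM -natrD ler_nat.
  by move: h0'; rewrite !mulrDl; lra.
- move=> z hz.
  have supp f : ~~ supports_cycle f -> z f = 0.
    by apply: contraNeq => zf; apply/asboolP; exists z.
  have -> : \sum_f W f *~ z f = \sum_f W0 f *~ z f.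
    by apply: eq_bigr => f _; rewrite /W; case: ifPn => // /supp ->; rewrite !mulr0z.
  under [RHS]eq_bigr do rewrite !mulrzBl.
  rewrite !sumrB.
  have -> : \sum_f single_face f *~ Ee *~ z f = z *~ Ee.
    rewrite -[in RHS](sum_single z) mulrz_suml.
    by apply: eq_bigr => f _; rewrite mulrzAC.
  have bdz e : \sum_f bd_cell f e * z f = 0.
    move: (congr1 (fun g : {ffun edge X -> int} => g e) hz).
    rewrite /bd2 sum_ffunE ffunE => h; rewrite -[RHS]h.
    by apply: eq_bigr => f _; rewrite ffunMzE mulrzz.
  have -> : \sum_f (\sum_e A e *~ bd_cell f e) *~ z f = 0.
    under eq_bigr do rewrite mulrz_suml.
    rewrite exchange_big big1// => e _.
    under eq_bigr do rewrite -mulrzA.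
    by rewrite -mulrz_sumr bdz mulr0z.
  (* Additivity of [q i] on [K] moves the sum over [f] inside, where [\sum_f w f *~ z f] vanishes by
     [bdz]. *)
  have -> : \sum_f (\sum_i D i *~ q i (w f)) *~ z f = 0.
    under eq_bigr do rewrite mulrz_suml.
    rewrite exchange_big big1// => i _.
    under eq_bigr do rewrite -mulrzA -qM//.
    rewrite -mulrz_sumr -qS; last by move=> f; apply: (subgroup_mulz K0 KB).
    have -> : \sum_f w f *~ z f = 0; last by rewrite q0 mulr0z.
    apply/ffunP => j; rewrite sum_ffunE [RHS]ffunE.
    under eq_bigr do rewrite ffunMzE ffunE mulrzz mulr_suml.
    rewrite exchange_big big1// => e _.
    under eq_bigr do rewrite -mulrA.
    by rewrite -mulr_sumr bdz mulr0.
  by rewrite !subr0.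
Qed.

End Core.

(** * Chains of loops *)

Section PathChains.
Variable X : polycomplex.
Implicit Types (p q : seq (edge X * bool)) (d : edge X * bool).

Definition path_chain p : {ffun edge X -> int} :=
  [ffun e => \sum_(d <- p | d.1 == e) (if d.2 then 1 else -1)].

Lemma path_chain_cat p q : path_chain (p ++ q) = path_chain p + path_chain q.
Proof. by apply/ffunP => e; rewrite !ffunE big_cat. Qed.

Lemma path_chain_nil : path_chain [::] = 0.
Proof. by apply/ffunP => e; rewrite !ffunE big_nil. Qed.

Lemma path_chain1 d e : path_chain [:: d] e = if d.1 == e then (if d.2 then 1 else -1) else 0.
Proof. by rewrite ffunE big_cons big_nil addr0. Qed.

Lemma path_chain_cons d p : path_chain (d :: p) = path_chain [:: d] + path_chain p.
Proof. by rewrite -path_chain_cat. Qed.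

Lemma path_chain_flip d : path_chain [:: flip d] = - path_chain [:: d].
Proof.
apply/ffunP => e; rewrite path_chain1 ffunE path_chain1 /=.
by case: eqP => _; rewrite ?oppr0//; case: d.2; rewrite ?opprK.
Qed.

Lemma path_chain_inv p : path_chain (inv_path p) = - path_chain p.
Proof.
elim: p => [|d p IH]; first by rewrite /inv_path /= path_chain_nil oppr0.
rewrite /inv_path /= rev_cons -cats1 path_chain_cat -/(inv_path p) IH.
by rewrite path_chain_flip [in RHS]path_chain_cons opprD addrC.
Qed.

Lemma l1_path_chain1 d : l1 (path_chain [:: d]) = 1%N.
Proof.
rewrite /l1 (bigD1 d.1)//= path_chain1 eqxx big1 => [|e]; first by case: d.2.
by rewrite path_chain1 eq_sym => /negPf ->.
Qed.

Lemma l1_path_chain p : (l1 (path_chain p) <= size p)%N.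
Proof.
elim: p => [|d p IH]; first by rewrite path_chain_nil l1_0.
by rewrite path_chain_cons (leq_trans (l1D _ _))// l1_path_chain1.
Qed.

Lemma walk_bd (f : face X) : exists u : vertex X, walk u (bd f) u.
Proof.
have walk_path (d d' : dart X) p :
    path.path (fun a b => fin a == org b) d (rcons p d') -> walk (fin d) p (org d').
  elim: p d => [|a p IH] d /=; first by rewrite andbT.
  by case/andP => /eqP -> /IH ->; rewrite eqxx.
have := bd_size f; have := bd_closed f; case: (bd f) => [//|d p] /= h _.
by exists (org d); rewrite eqxx; apply: walk_path.
Qed.

Lemma bd_cellE (f : face X) : bd_cell f = path_chain (bd f).
Proof. by []. Qed.

Lemma l1_bd_cell (f : face X) : (l1 (bd_cell f) <= size (bd f))%N.
Proof. exact: l1_path_chain. Qed.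

Variable geo : vertex X -> seq (dart X).

Definition edge_loop_chain (e : edge X) : {ffun edge X -> int} :=
  path_chain (geo (src e)) + path_chain [:: (e, true)] - path_chain (geo (tgt e)).

(** The terms of consecutive darts telescope. For a closed walk the two end terms cancel, which
    gives the formula for [bd_cell f]. *)
Lemma edge_loop_chain_walk u p w : walk u p w ->
  \sum_e edge_loop_chain e *~ path_chain p e =
  path_chain (geo u) + path_chain p - path_chain (geo w).
Proof.
elim: p u => [|d p IH] u /=.
  move=> /eqP <-; rewrite path_chain_nil addr0 subrr big1// => e _.
  by rewrite ffunE mulr0z.
case/andP=> /eqP <- /IH h.
transitivity (\sum_e edge_loop_chain e *~ path_chain [:: d] e +
              \sum_e edge_loop_chain e *~ path_chain p e).
  by rewrite -big_split; apply: eq_bigr => e _; rewrite path_chain_cons ffunE mulrzDr.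
rewrite h [in RHS]path_chain_cons.
suff -> : \sum_e edge_loop_chain e *~ path_chain [:: d] e =
    path_chain (geo (org d)) + path_chain [:: d] - path_chain (geo (fin d)).
  by rewrite !addrA subrK.
rewrite (bigD1 d.1)//= big1 ?addr0 => [|e /negPf de]; last first.
  by rewrite path_chain1 eq_sym de mulr0z.
rewrite path_chain1 eqxx /edge_loop_chain /org /fin /dart_org /dart_end.
case: d {h IH} => e [] /=; first by rewrite mulr1z.
rewrite mulrN1z -[(e, false)]/(flip (e, true)) path_chain_flip.
by rewrite opprB opprD addrA addrAC.
Qed.

Lemma edge_loop_chain_bd f :
  bd_cell f = \sum_e edge_loop_chain e *~ bd_cell f e.
Proof.
have [u h] := walk_bd f.
by rewrite bd_cellE (edge_loop_chain_walk h) addrAC subrr add0r.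
Qed.

End PathChains.

Section LoopChains.
Variables (X : polycomplex) (v : vertex X).

Let B : set {ffun edge X -> int} := range (@bd2 X).
Let B0 : B 0 := boundary0 X.
Let BB := @boundaryB X.

Definition loop_chain (q : loop v) := path_chain (sval q).

Lemma loop_chain_mul p q : loop_chain (loop_mul p q) = loop_chain p + loop_chain q.
Proof. exact: path_chain_cat. Qed.

Lemma loop_chain_inv p : loop_chain (loop_inv p) = - loop_chain p.
Proof. exact: path_chain_inv. Qed.

(** Deleting a spur leaves the chain unchanged, and deleting a turn around [f] subtracts
    [bd_cell f]. *)
Lemma homotopic_boundary p q : homotopic p q ->
  range (@bd2 X) (loop_chain p - loop_chain q).
Proof.
elim=> {p q} [p q [u d w hp hq|u f w hp hq]|p|p q _ h|p q s _ h1 _ h2].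
- have -> : loop_chain p - loop_chain q = 0; last exact: boundary0.
  rewrite /loop_chain hp hq !path_chain_cat (path_chain_cons d) path_chain_flip.
  by rewrite subrr add0r subrr.
- have -> : loop_chain p - loop_chain q = bd_cell f.
    by rewrite /loop_chain hp hq !path_chain_cat bd_cellE addrCA addrK.
  by rewrite -bd2_single; exists (single_face f).
- by rewrite subrr; exact: boundary0.
- by rewrite -opprB; apply: (subgroup_opp B0 BB).
- by rewrite -[_ - _](subrKA (loop_chain q)); apply: (subgroup_add B0 BB).
Qed.

(** The Hurewicz map, read on chosen representatives; it is a homomorphism only modulo [B]. *)
Let phi (x : pi1 v) := loop_chain (repr x).

Let phi_class p : B (phi (loop_class p) - loop_chain p).
Proof. exact/homotopic_boundary/homotopic_repr. Qed.

Let phiM x y : B (phi (x * y)%g - (phi x + phi y)).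
Proof. by rewrite -loop_chain_mul; exact: phi_class. Qed.

Let phiV x : B (phi x^-1%g + phi x).
Proof.
by rewrite -[phi x]opprK -loop_chain_inv; exact: phi_class.
Qed.

Let kernel : set (pi1 v) := [set x | B (phi x)].

Let kernelM x y : B (phi x + phi y) -> kernel (x * y)%g.
Proof.
move=> h; rewrite /kernel /= -(subrK (phi x + phi y) (phi (x * y)%g)).
exact: (subgroup_add B0 BB).
Qed.

(** The target modulo [B] is abelian, so the kernel is a subgroup containing all commutators. *)
Let derived_kernel : derived_subgroup (G := pi1 v) `<=` kernel.
Proof.
move=> x; apply; split; first split.
- have := phi_class (loop_one v).
  by rewrite [loop_chain _]path_chain_nil subr0.
- move=> y z hy hz; apply: kernelM; apply: (subgroup_add B0 BB) => //.
  by have := BB (phiV z) hz; rewrite addrK.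
- move=> y z; rewrite /commg /conjg; apply: kernelM.
  have h1 := phiM z^-1%g (y * z)%g; have h2 := phiM y z.
  have := subgroup_add B0 BB (subgroup_add B0 BB h1 h2) (subgroup_add B0 BB (phiV y) (phiV z)).
  congr (B _); move: (phi _) (phi _) (phi _) (phi _) (phi _) (phi _) => a b c d e f.
  by apply/ffunP => k; rewrite !ffunE; lia.
Qed.

(** By pigeonhole two loops lie in the same coset of the derived subgroup, on which the Hurewicz map
    vanishes modulo boundaries. *)
Lemma loops_finite_index (J : finType) (q : J -> loop v) :
  rationally_perfect (pi1 v) -> (card_ab (pi1 v) < #|J|)%N ->
  exists j j', j <> j' /\ range (@bd2 X) (loop_chain (q j) - loop_chain (q j')).
Proof.
move=> fin hJ.
pose coset j := [set (loop_class (q j) * h)%g | h in derived_subgroup (G := pi1 v)].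
have cosetP j : coset j \in fset_set (abelianization (G := pi1 v)).
  by rewrite in_fset_set// inE; exists (loop_class (q j)).
have [j [j' [jj' eq]]] : exists j j', j <> j' /\ coset j = coset j'.
  apply: contrapT => h.
  have inj : injective coset.
    by move=> j j' eq; apply: contrapT => ne; apply: h; exists j, j'.
  move: hJ; rewrite ltnNge => /negP; apply.
  rewrite cardE -(size_map coset); apply: uniq_leq_size.
    by rewrite map_inj_uniq ?enum_uniq.
  by move=> _ /mapP [j _ ->].
exists j, j'; split => //.
have D1 : derived_subgroup (G := pi1 v) 1%g by move=> H [[]].
have [h Dh hE] : coset j' (loop_class (q j)).
  by rewrite -eq; exists 1%g => //; rewrite mulg1.
have := phi_class (q j); rewrite -hE => h1.
have h2 := phiM (loop_class (q j')) h.
have h3 := phi_class (q j').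
have := subgroup_add B0 BB (BB h2 h1) (subgroup_add B0 BB (derived_kernel Dh) h3).
congr (B _); move: (phi _) (phi _) (phi _) (loop_chain _) (loop_chain _) => a b c d e.
apply/ffunP => k; rewrite !ffunE; ring.
Qed.

End LoopChains.

(** * Chords of regular polygons and the path metric *)

Section ChordArc.
Variable R : realType.
Implicit Types (x y : R).

(** The triple angle formula at [pi] reads [(c + 1) * (2 * c - 1) ^ 2 = 0] with [c > 0]. *)
Lemma cos_pi_third : cos (pi / 3) = 1 / 2 :> R.
Proof.
have pi0 := pi_gt0 R.
have c0 : 0 < cos (pi / 3 : R) by apply: cos_gt0_pihalf; lra.
have h : cos (pi / 3 + (pi / 3) *+ 2) = -1 :> R.
  by rewrite -cospi; congr cos; rewrite mulr2n; field.
move: h; rewrite cosD cos_mulr2n sin_mulr2n !(mulr2n (_ ^+ 2)) !(mulr2n (_ * _)).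
have := sin2cos2 (pi / 3 : R); move: (cos _) (sin _) c0 => c s c0 hs h.
have : (c + 1) * (2 * c - 1) ^+ 2 = 0 by nra.
move/eqP; rewrite mulf_eq0 sqrf_eq0 => /orP [|] /eqP; lra.
Qed.

Lemma cos_ge_half y : 0 <= y <= pi / 3 -> 1 / 2 <= cos y.
Proof.
have pi0 := pi_gt0 R.
move=> /andP[y0 y3]; rewrite -cos_pi_third.
have [->//|ne] := eqVneq y (pi / 3).
by apply: ltW; rewrite ltr_cos ?in_itv/= ?lt_neqAle ?ne//; apply/andP; split; lra.
Qed.

Lemma sin_mvt y : 0 <= y -> exists2 c : R, 0 <= c <= y & sin y = cos c * y.
Proof.
move=> y0; have [|c hc] := @MVT_segment R sin cos 0 y y0.
  by apply: continuous_subspaceT; exact: continuous_sin.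
by rewrite sin0 !subr0 => ?; exists c.
Qed.

Lemma sin_le_id y : 0 <= y -> sin y <= y.
Proof.
move=> y0; have [c _ ->] := sin_mvt y0.
by rewrite ler_piMl// cos_le1.
Qed.

(** On [[0, pi / 3]] the mean value theorem gives the slope 1/2; up to [pi / 2] the double angle
    formula loses another factor 2. *)
Lemma sin_ge_quarter y : 0 <= y <= pi / 2 -> y / 4 <= sin y.
Proof.
have pi0 := pi_gt0 R.
have third (z : R) : 0 <= z <= pi / 3 -> z / 2 <= sin z.
  move=> /andP[z0 z3]; have [c /andP[c0 cz] ->] := sin_mvt z0.
  have : 1 / 2 <= cos c by apply: cos_ge_half; lra.
  by move=> h; rewrite mulrC -[_^-1]mul1r ler_wpM2r.
move=> /andP[y0 y2].
have [y3|y3] := leP y (pi / 3).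
  by have := third y; rewrite y0 y3 => /(_ isT); lra.
have -> : y = (y / 2) *+ 2 by rewrite mulr2n; field.
have h1 : (y / 2) / 2 <= sin (y / 2) by apply: third; lra.
have h2 : 1 / 2 <= cos (y / 2) by apply: cos_ge_half; lra.
rewrite sin_mulr2n -(mulr_natl (y / 2)) -(mulr_natl (cos _ * _)).
have : 0 <= (cos (y / 2) - 1 / 2) * sin (y / 2) by apply: mulr_ge0; lra.
by rewrite mulrBl; lra.
Qed.

Lemma euclid_ge0 (p q : R * R) : 0 <= euclid p q.
Proof. exact: sqrtr_ge0. Qed.

(** Cauchy-Schwarz against the unit vector [(- sin b, cos b)]. *)
Lemma inner_le_euclid (p q : R * R) (b : R) :
  - sin b * (q.1 - p.1) + cos b * (q.2 - p.2) <= euclid p q.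
Proof.
rewrite /euclid; set e := (X in Num.sqrt X).
have e0 : 0 <= e by rewrite addr_ge0 ?sqr_ge0.
apply: le_trans (ler_norm _) _; rewrite -sqrtr_sqr ler_sqrt//.
set u := q.1 - p.1; set w := q.2 - p.2.
have -> : e = (cos b ^+ 2 + sin b ^+ 2) * (u ^+ 2 + w ^+ 2).
  by rewrite cos2Dsin2 mul1r /e /u /w; ring.
rewrite -subr_ge0; have := sqr_ge0 (cos b * u + sin b * w).
by congr (_ <= _); ring.
Qed.

(* [(- sin b, cos b)] is the direction from the midpoint of side [k] to that of
   side [k + m]. *)
Lemma side_inner n k m (t s : R) : (2 < n)%N ->
  let x := pi / n%:R in
  let b := (2 * k + m + 1)%N%:R * x in
  - sin b * ((side n (k + m) s).1 - (side n k t).1) +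
    cos b * ((side n (k + m) s).2 - (side n k t).2) =
  ((1 - s + t) * sin ((m%:R - 1) * x) + (1 + s - t) * sin ((m%:R + 1) * x)) / (2 * sin x).
Proof.
move=> n2 x b.
have n0 : 0 < n%:R :> R by rewrite ltr0n; lia.
have corner_inner a : - sin b * (corner R n a).1 + cos b * (corner R n a).2 =
    sin (2 * a%:R * x - b) / (2 * sin x).
  rewrite /corner /= -/x (_ : 2 * pi * a%:R / n%:R = 2 * a%:R * x); last by rewrite /x; ring.
  by rewrite sinB; ring.
rewrite /side; cbn [fst snd].
transitivity ((1 - s) * (sin (2 * (k + m)%:R * x - b) / (2 * sin x)) +
   s * (sin (2 * (k + m).+1%:R * x - b) / (2 * sin x)) -
   (1 - t) * (sin (2 * k%:R * x - b) / (2 * sin x)) -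
   t * (sin (2 * k.+1%:R * x - b) / (2 * sin x))).
  by rewrite -!corner_inner; ring.
have -> : 2 * (k + m)%:R * x - b = (m%:R - 1) * x by rewrite /b; ring.
have -> : 2 * (k + m).+1%:R * x - b = (m%:R + 1) * x by rewrite /b; ring.
have -> : 2 * k%:R * x - b = - ((m%:R + 1) * x) by rewrite /b; ring.
have -> : 2 * k.+1%:R * x - b = - ((m%:R - 1) * x) by rewrite /b; ring.
by rewrite !sinN; ring.
Qed.

(** The left side is the signed length of the boundary arc between the two points. The chord is
    bounded below by its projection onto the direction of [side_inner]; as [2 * m <= n], the angles
    involved stay where the sine is comparable to its argument. *)
Lemma chord_arc n k m (t s : R) : (2 < n)%N -> (2 * m <= n)%N ->
  0 <= t <= 1 -> 0 <= s <= 1 ->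
  m%:R + s - t <= 16 * euclid (side n k t) (side n (k + m) s).
Proof.
move=> n2 mn /andP[t0 t1] /andP[s0 s1].
have [/andP[/eqP mE st]|mst] := boolP ((m == 0%N) && (s <= t)).
  have := euclid_ge0 (side n k t) (side n (k + m) s).
  by rewrite {2}mE; lra.
have pi0 := pi_gt0 R.
have n0 : 0 < n%:R :> R by rewrite ltr0n; lia.
pose x : R := pi / n%:R.
have := inner_le_euclid (side n k t) (side n (k + m) s) ((2 * k + m + 1)%N%:R * x).
rewrite side_inner// -/x.
have n3 : 3 <= n%:R :> R by rewrite ler_nat.
have xn : x * n%:R = pi by rewrite /x divfK// gt_eqF.
have x0 : 0 < x by rewrite divr_gt0.
have x3 : x <= pi / 3 by rewrite /x ler_pM2l// lef_pV2// posrE.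
have S1 : 0 < sin x by apply: sin_gt0_pi; lra.
have S1x : sin x <= x by rewrite sin_le_id// ltW.
have Cx : 1 / 2 <= cos x by apply: cos_ge_half; lra.
have mx : m%:R * x <= pi / 2.
  have : 2 * m%:R <= n%:R :> R by rewrite -natrM ler_nat.
  by move/(ler_wpM2r (ltW x0)); rewrite mulrC mulrA -(mulrC x) xn; lra.
have m0 : 0 <= m%:R * x by rewrite mulr_ge0// ltW.
have Cm : 0 <= cos (m%:R * x) by apply: cos_ge0_pihalf; lra.
have difS : sin ((m%:R + 1) * x) - sin ((m%:R - 1) * x) = 2 * cos (m%:R * x) * sin x.
  by rewrite mulrBl mulrDl mul1r sinB sinD; ring.
set S' := sin ((m%:R - 1) * x) in difS *.
set S2 := sin ((m%:R + 1) * x) in difS *.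
set g := (_ / _) => hg; apply: (@le_trans _ _ (16 * g)); last by rewrite ler_pM2l.
have hg' : g * (2 * sin x) = (1 - s + t) * S' + (1 + s - t) * S2.
  by rewrite /g divfK// gt_eqF// mulr_gt0.
have S'S2 : 0 <= S2 - S' by rewrite difS !mulr_ge0// ltW.
have u0 : 0 <= 1 + s - t by lra.
have [mE|m_gt0] := posnP m.
  have st : t < s by rewrite ltNge; move: mst; rewrite mE.
  rewrite -(@ler_pM2r _ (2 * sin x)) ?mulr_gt0// -mulrA hg'.
  have -> : S2 = sin x by rewrite /S2 mE add0r mul1r.
  have -> : S' = - sin x by rewrite /S' mE sub0r mulN1r sinN.
  rewrite -subr_ge0; have : 0 <= 30 * ((s - t) * sin x) by rewrite !mulr_ge0 ?(ltW S1)//; lra.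
  by congr (_ <= _); rewrite mE; ring.
rewrite -(@ler_pM2r _ (2 * sin x)) ?mulr_gt0// -mulrA hg'.
(* For [m = 1] the sine [S'] vanishes and [S2] must carry the estimate; for [m >= 2] the bound
   [S' <= S2] leaves [2 * S'], and [m + 1 <= 4 * (m - 1)]. *)
have [m1|m2] := leqP m 1.
  have mE : m = 1%N by apply/eqP; rewrite eqn_leq m1.
  have S'0 : S' = 0 by rewrite /S' mE subrr mul0r sin0.
  have -> : S2 = 2 * cos x * sin x by move: difS; rewrite S'0 subr0 mE mul1r.
  rewrite S'0.
  rewrite -subr_ge0; have : 0 <= (1 + s - t) * ((32 * cos x - 2) * sin x).
    by rewrite !mulr_ge0 ?(ltW S1)//; lra.
  by congr (_ <= _); rewrite mE; ring.
have m2' : 2 <= m%:R :> R by rewrite ler_nat.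
have S'q : (m%:R - 1) * x / 4 <= S'.
  apply: sin_ge_quarter; apply/andP; split; last by rewrite mulrBl mul1r; lra.
  by rewrite mulr_ge0 ?(ltW x0)//; lra.
have h1 : 2 * S' <= (1 - s + t) * S' + (1 + s - t) * S2.
  rewrite -subr_ge0; have := mulr_ge0 u0 S'S2.
  by congr (_ <= _); ring.
have h2 : (m%:R + s - t) * (2 * sin x) <= (m%:R + 1) * (2 * x).
  by apply: ler_pM; lra.
have h3 : (m%:R + 1) * (2 * x) <= 16 * (2 * ((m%:R - 1) * x / 4)).
  rewrite -subr_ge0; have : 0 <= (6 * m%:R - 10) * x by rewrite mulr_ge0 ?(ltW x0)//; lra.
  by congr (_ <= _); field.
by lra.
Qed.

End ChordArc.

Section Euclid.
Variable R : realType.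
Implicit Types p q r : R * R.

Lemma euclidC p q : euclid p q = euclid q p.
Proof. by rewrite /euclid; congr Num.sqrt; ring. Qed.

Lemma euclidxx p : euclid p p = 0.
Proof. by rewrite /euclid !subrr expr0n addr0 sqrtr0. Qed.

(** Squaring reduces the claim to Cauchy-Schwarz, which follows from [(a * e - b * c) ^ 2 >= 0]. *)
Lemma euclid_triangle q p r : euclid p r <= euclid p q + euclid q r.
Proof.
have sq (a b : R * R) : euclid a b ^+ 2 = (a.1 - b.1) ^+ 2 + (a.2 - b.2) ^+ 2.
  by rewrite sqr_sqrtr// addr_ge0 ?sqr_ge0.
have := sq p q; have := sq q r; have := euclid_ge0 p q; have := euclid_ge0 q r.
rewrite [euclid p r]/euclid; move: (euclid p q) (euclid q r) => A B B0 A0 hB hA.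
rewrite -[leRHS]ger0_norm ?addr_ge0// -sqrtr_sqr ler_sqrt ?sqr_ge0//.
set a := p.1 - q.1 in hA; set b := p.2 - q.2 in hA.
set c := q.1 - r.1 in hB; set e := q.2 - r.2 in hB.
have -> : p.1 - r.1 = a + c by rewrite /a /c; ring.
have -> : p.2 - r.2 = b + e by rewrite /b /e; ring.
suff h : a * c + b * e <= A * B by nra.
apply: le_trans (ler_norm _) _; rewrite -[A * B]ger0_norm ?mulr_ge0//.
rewrite -!sqrtr_sqr ler_sqrt ?sqr_ge0// exprMn hA hB.
have := sqr_ge0 (a * e - b * c); nra.
Qed.

Lemma side_periodic n k (t : R) : (0 < n)%N -> side n (k + n) t = side n k t.
Proof.
move=> n0; have nn : n%:R != 0 :> R by rewrite pnatr_eq0 -lt0n.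
have corner_periodic j : corner R n (j + n) = corner R n j.
  rewrite /corner.
  have -> : 2 * pi * (j + n)%:R / n%:R = 2 * pi * j%:R / n%:R + pi *+ 2 :> R.
    by rewrite natrD mulr2n; field.
  by rewrite cosD2pi sinD2pi.
by rewrite /side -addSn !corner_periodic.
Qed.

End Euclid.

(** * Lipschitz extension from the vertices to the complex *)

Section Lipschitz.
Variables (R : realType) (X : polycomplex) (d : vertex X -> R).
Hypothesis d_ge0 : forall w, 0 <= d w.
Hypothesis d_lip : forall e : edge X, `|d (src e) - d (tgt e)| <= 1.

(** The largest 1-Lipschitz function on the unit interval with the prescribed values at the two
    ends. *)
Definition dart_fun (a : dart X) (t : R) : R :=
  Num.min (d (org a) + t) (d (fin a) + 1 - t).

Lemma dart_lip (a : dart X) : -1 <= d (org a) - d (fin a) <= 1.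
Proof.
rewrite -ler_norml; by case: a => e []; [|rewrite distrC]; exact: d_lip.
Qed.

Lemma dart_fun0 a : dart_fun a 0 = d (org a).
Proof. by rewrite /dart_fun addr0 subr0 min_l//; have/andP[] := dart_lip a; lra. Qed.

Lemma dart_fun1 a : dart_fun a 1 = d (fin a).
Proof. by rewrite /dart_fun addrK min_r//; have/andP[] := dart_lip a; lra. Qed.

Lemma dart_funE (a : dart X) t :
  dart_fun a t = dart_fun (a.1, true) (if a.2 then t else 1 - t).
Proof.
case: a => e [] //=; rewrite /dart_fun /org /fin /dart_org /dart_end /= minC.
by congr Num.min; ring.
Qed.

Lemma dart_fun_lip a s t : `|dart_fun a s - dart_fun a t| <= `|s - t|.
Proof.
rewrite /dart_fun; set u := d (org a); set w := d (fin a).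
by case: (leP (u + s)); case: (leP (u + t)) => h1 h2; case: (ger0P (s - t)) => h3;
  rewrite ler_norml; apply/andP; split; lra.
Qed.

Lemma dart_fun_ge0 a t : 0 <= t <= 1 -> 0 <= dart_fun a t.
Proof.
move=> /andP[t0 t1]; have := d_ge0 (org a); have := d_ge0 (fin a).
by rewrite /dart_fun le_min => h1 h2; apply/andP; split; lra.
Qed.

Definition sides (f : face X) : set ('I_(size (bd f)) * R) := [set k | 0 <= k.2 <= 1].
Arguments sides : clear implicits.

(* On a face this is the McShane extension of the values on its boundary. *)
Definition point_fun (x : Defs.point R X) : R :=
  match x with
  | at_vertex w => d w
  | at_edge e t => dart_fun (e, true) t
  | at_face f p => inf [set dart_fun (tnth (in_tuple (bd f)) k.1) k.2 +
      16 * euclid p (side (size (bd f)) k.1 k.2) | k in sides f]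
  end.

(** Along the boundary the function is 1-Lipschitz for arc length, and the shorter of the two arcs
    is at most 16 times the chord. *)
Lemma boundary_lip (f : face X) (k j : 'I_(size (bd f))) (t s : R) :
  0 <= t <= 1 -> 0 <= s <= 1 ->
  `|dart_fun (tnth (in_tuple (bd f)) k) t - dart_fun (tnth (in_tuple (bd f)) j) s| <=
  16 * euclid (side (size (bd f)) k t) (side (size (bd f)) j s).
Proof.
have a0 : dart X := tnth (in_tuple (bd f)) k.
rewrite !(tnth_nth a0) /=.
set n := size (bd f) in k j *.
have n2 : (2 < n)%N := bd_size f.
have n0 : (0 < n)%N by lia.
(* Sides are indexed by all naturals modulo [n], so that an arc may run past the last side. *)
pose phi i := dart_fun (nth a0 (bd f) (i %% n)).
have -> : dart_fun (nth a0 (bd f) k) t = phi k t by rewrite /phi modn_small.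
have -> : dart_fun (nth a0 (bd f) j) s = phi j s by rewrite /phi modn_small.
have next i : phi i 1 = phi i.+1 0.
  rewrite /phi dart_fun1 dart_fun0; congr d.
  have := bd_closed f; rewrite -/n in n2 n0 *.
  have : (i %% n < n)%N by rewrite ltn_mod.
  rewrite -[i.+1]addn1 -modnDml addn1; move: (i %% n)%N => {}i.
  rewrite /n; case: (bd f) => [//|b p] /= ip /(pathP a0).
  rewrite size_rcons => /(_ i ip) /eqP.
  rewrite -rcons_cons !nth_rcons /= ip /fin /org => ->.
  move: ip; rewrite ltnS leq_eqVlt => /orP [/eqP ->|ip].
    by rewrite ltnn eqxx modnn.
  by rewrite ip modn_small.
have phi_lip i (x y : R) : `|phi i x - phi i y| <= `|x - y| by exact: dart_fun_lip.
have arc1 i m (x : R) : x <= 1 -> `|phi (i + m)%N 1 - phi i x| <= m%:R + 1 - x.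
  move=> x1; elim: m => [|m IH].
    by rewrite addn0 add0r (le_trans (phi_lip _ _ _))// ger0_norm// subr_ge0.
  have := phi_lip (i + m.+1)%N 1 0; rewrite subr0 normr1 addnS -next -natr1 => h.
  by have := ler_distD (phi (i + m)%N 1) (phi (i + m).+1%N 1) (phi i x); lra.
have arc i m (x y : R) : x <= 1 -> 0 <= y -> `|phi (i + m.+1)%N y - phi i x| <= m.+1%:R + y - x.
  move=> x1 y0; have := arc1 i m x x1; have := phi_lip (i + m).+1 y 0.
  rewrite addnS -next subr0 (ger0_norm y0) -natr1 => h1 h2.
  by have := ler_distD (phi (i + m)%N 1) (phi (i + m).+1%N y) (phi i x); lra.
have short i m (x y : R) : (2 * m <= n)%N -> 0 <= x <= 1 -> 0 <= y <= 1 ->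
    `|phi (i + m)%N y - phi i x| <= 16 * euclid (side n i x) (side n (i + m) y).
  case: m => [|m] hm hx hy.
    rewrite addn0; apply: (le_trans (phi_lip _ _ _)).
    (* Both points lie on one side in unknown order, and the arc length is signed, so both orders
       are used. *)
    have := chord_arc i n2 hm hx hy; have := chord_arc i n2 hm hy hx.
    by rewrite addn0 add0r (euclidC (side n i y)) => h1 h2;
      rewrite ler_norml; apply/andP; split; lra.
  apply: le_trans (chord_arc i n2 hm hx hy).
  by apply: arc; [case/andP: hx|case/andP: hy].
wlog kj : k j t s / (k <= j)%N.
  move=> h ht hs; case: (leqP k j) => kj; first exact: h.
  by rewrite distrC euclidC; apply: h => //; exact: ltnW.
move=> ht hs; have jn := ltn_ord j.
have [h|h] := leqP (2 * (j - k)) n.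
  by have := short k (j - k)%N t s h ht hs; rewrite subnKC// distrC.
(* The other arc is the short one; it runs from side [j] to side [k + n], which is side [k]
   again. *)
have h' : (2 * (k + n - j) <= n)%N by lia.
have := short j (k + n - j)%N s t h' hs ht.
rewrite subnKC; last by lia.
by rewrite side_periodic// euclidC /phi modnDr.
Qed.

Lemma sides_neq0 f : exists k, sides f k.
Proof.
have h : (0 < size (bd f))%N by have := bd_size f; lia.
by exists (Ordinal h, 0); rewrite /sides /= lexx ler01.
Qed.

Lemma point_fun_face_le f p k : sides f k ->
  point_fun (at_face f p) <= dart_fun (tnth (in_tuple (bd f)) k.1) k.2 +
      16 * euclid p (side (size (bd f)) k.1 k.2).
Proof.
move=> hk; apply: ge_inf; last by exists k.
by exists 0 => _ [l hl <-]; rewrite addr_ge0 ?dart_fun_ge0// mulr_ge0// euclid_ge0.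
Qed.

Lemma le_point_fun_face f p c :
  (forall k, sides f k -> c <= dart_fun (tnth (in_tuple (bd f)) k.1) k.2 +
      16 * euclid p (side (size (bd f)) k.1 k.2)) ->
  c <= point_fun (at_face f p).
Proof.
move=> h; apply: lb_le_inf; last by move=> _ [k hk <-]; exact: h.
have [k hk] := sides_neq0 f; eexists; exists k => //.
Qed.

Lemma point_fun_face_lip f p q :
  `|point_fun (at_face f p) - point_fun (at_face f q)| <= 16 * euclid p q.
Proof.
suff h p' q' : point_fun (at_face f p') - 16 * euclid p' q' <= point_fun (at_face f q').
  have := h p q; have := h q p; rewrite (euclidC q) => h1 h2.
  by rewrite ler_norml; apply/andP; split; lra.
apply: le_point_fun_face => k hk; rewrite lerBlDr.
apply: (le_trans (point_fun_face_le p' hk)).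
have := euclid_triangle q' p' (side (size (bd f)) k.1 k.2); lra.
Qed.

(** By [boundary_lip] the boundary values are already 16-Lipschitz for the Euclidean distance, so
    the infimum does not lower them. *)
Lemma point_fun_side f (k : 'I_(size (bd f))) t : 0 <= t <= 1 ->
  point_fun (at_face f (side (size (bd f)) k t)) = dart_fun (tnth (in_tuple (bd f)) k) t.
Proof.
move=> ht; apply/eqP; rewrite eq_le; apply/andP; split.
  by have := @point_fun_face_le f (side (size (bd f)) k t) (k, t) ht; rewrite euclidxx mulr0 addr0.
apply: le_point_fun_face => -[j s] /= hs.
have := boundary_lip k j ht hs; rewrite ler_norml => /andP[_]; lra.
Qed.

Lemma point_fun_step x y l : step x y l -> `|point_fun x - point_fun y| <= 16 * l.
Proof.
have glue x' y' : glued x' y' -> point_fun x' = point_fun y'.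
  case=> [e|e|f k t ht].
  - by rewrite /= dart_fun0.
  - by rewrite /= dart_fun1.
  - by rewrite point_fun_side// dart_funE.
case=> [e s t _ _|f p q _ _|x' y' /glue ->|x' y' /glue ->].
- apply: (le_trans (dart_fun_lip _ _ _)); have := normr_ge0 (s - t); lra.
- exact: point_fun_face_lip.
- by rewrite subrr normr0 mulr0.
- by rewrite subrr normr0 mulr0.
Qed.

Lemma point_fun_string x y l : string x y l -> `|point_fun x - point_fun y| <= 16 * l.
Proof.
elim=> [z|x' y' z l' m /point_fun_step h _ IH]; first by rewrite subrr normr0 mulr0.
by have := ler_distD (point_fun y') (point_fun x') (point_fun z); lra.
Qed.

(** The given string makes the set of lengths nonempty; an empty infimum would default to 0. *)
Lemma point_fun_dist x y l : string x y l ->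
  `|point_fun x - point_fun y| <= 16 * path_dist x y.
Proof.
move=> h; rewrite mulrC -ler_pdivrMr//; apply: lb_le_inf; first by exists l.
by move=> m /point_fun_string hm; rewrite ler_pdivrMr// mulrC.
Qed.

End Lipschitz.

Lemma walk_edge (X : polycomplex) (e : edge X) :
  walk (src e) [:: (e, true)] (tgt e) /\ walk (tgt e) [:: (e, false)] (src e).
Proof. by rewrite /= /org /fin /dart_org /dart_end /= !eqxx. Qed.

(** * Combinatorial distance and the diameter *)

Section Diameter.
Variables (R : realType) (X : polycomplex) (v : vertex X).
Hypothesis conn : complex_connected X.

Lemma geodesics : exists geo : vertex X -> seq (dart X),
  (forall w, walk v (geo w) w) /\
  (forall w p, walk v p w -> (size (geo w) <= size p)%N).
Proof.
have /choice [geo hgeo] : forall w, exists p : seq (dart X),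
    walk v p w /\ forall q, walk v q w -> (size p <= size q)%N.
  move=> w; have ex : exists n, `[< exists2 p : seq (dart X), walk v p w & size p = n >].
    by have [p hp] := conn v w; exists (size p); apply/asboolP; exists p.
  case: (ex_minnP ex) => n /asboolP [p hp pn] hmin.
  exists p; split => // q hq; rewrite pn; apply: hmin.
  by apply/asboolP; exists q.
by exists geo; split => w; have [] := hgeo w.
Qed.

Lemma string_walk (u w : vertex X) p : walk u p w ->
  exists l : R, string (at_vertex R u) (at_vertex R w) l.
Proof.
elim: p u => [|[e b] p IH] u /=; first by move=> /eqP <-; exists 0; exact: string_nil.
case/andP => /eqP <- /IH [l hl].
have h0 : 0 <= (0 : R) <= 1 by rewrite lexx ler01.
have h1 : 0 <= (1 : R) <= 1 by rewrite lexx ler01.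
case: b hl; rewrite /org /fin /dart_org /dart_end /= => hl.
  exists (0 + (`|0 - 1| + (0 + l))).
  apply: string_cons (step_unglue (glue_src R e)) _.
  apply: string_cons (step_edge e h0 h1) _.
  exact: string_cons (step_glue (glue_tgt R e)) hl.
exists (0 + (`|1 - 0| + (0 + l))).
apply: string_cons (step_unglue (glue_tgt R e)) _.
apply: string_cons (step_edge e h1 h0) _.
exact: string_cons (step_glue (glue_src R e)) hl.
Qed.

Lemma string_ge0 (x y : Defs.point R X) l : string x y l -> 0 <= l.
Proof.
elim=> [//|x' y' z l' m st _ m0]; apply: addr_ge0 => //.
by case: st => // *; exact: euclid_ge0.
Qed.

Lemma path_dist_ge0 (x y : Defs.point R X) : 0 <= path_dist x y.
Proof.
have [[l hl]|h] := pselect (exists l, string x y l).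
  by apply: lb_le_inf => [|m /string_ge0//]; exists l.
rewrite /path_dist (_ : [set l | string x y l] = set0) ?inf0//.
by apply/seteqP; split => // l hl; apply: h; exists l.
Qed.

(** The supremum of an unbounded set defaults to 0, so a nonzero [diam] certifies boundedness. *)
Lemma path_dist_le_diam (x y : Defs.point R X) : diam R X != 0 ->
  is_point x -> is_point y -> path_dist x y <= diam R X.
Proof.
move=> dn hx hy; rewrite /diam.
set D := (X in sup X).
have Dxy : D (path_dist x y) by exists (x, y).
apply: ub_le_sup => //.
apply: contrapT => nb; move/eqP: dn; apply; rewrite /diam -/D.
by apply: sup_out => -[].
Qed.

Lemma diam_ge0 : 0 <= diam R X.
Proof.
have [->//|dn] := eqVneq (diam R X) 0.
exact: le_trans (path_dist_ge0 _ _) (@path_dist_le_diam (at_vertex R v) (at_vertex R v) dn I I).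
Qed.

(** Extending the zero function on vertices gives the value 1/2 at the midpoint of [e], so that
    midpoint is at distance at least 1/32 from [src e]. *)
Lemma edge_le_diam (e : edge X) : diam R X != 0 -> 1 <= 32 * diam R X.
Proof.
move=> dn.
have h2 : 0 <= (2^-1 : R) <= 1 by lra.
have h0 : 0 <= (0 : R) <= 1 by rewrite lexx ler01.
have d0 (w : vertex X) : 0 <= (0 : R) by [].
have dl (f : edge X) : `|(0 : R) - 0| <= 1 by rewrite subrr normr0.
have st : string (at_vertex R (src e)) (at_edge e (2^-1)) (0 + (`|0 - 2^-1| + 0)).
  apply: string_cons (step_unglue (glue_src R e)) _.
  exact: string_cons (step_edge e h0 h2) (string_nil _).
have := point_fun_dist (d := fun=> 0) d0 dl st.
rewrite /= /dart_fun !add0r (_ : 1 - 2^-1 = 2^-1); last by field.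
rewrite minxx normrN ger0_norm ?invr_ge0//.
have := @path_dist_le_diam (at_vertex R (src e)) (at_edge e (2^-1)) dn I h2.
clear d0 dl; lra.
Qed.

Variable geo : vertex X -> seq (dart X).
Hypothesis geo_walk : forall w, walk v (geo w) w.
Hypothesis geo_min : forall w p, walk v p w -> (size (geo w) <= size p)%N.

(** The combinatorial distance from [v] changes by at most 1 across an edge, so its extension to the
    complex is 16-Lipschitz for the path metric. *)
Lemma geo_le_diam w : diam R X != 0 -> (size (geo w))%:R <= 16 * diam R X.
Proof.
move=> dn; pose d u : R := (size (geo u))%:R.
have d0 u : 0 <= d u by exact: ler0n.
have dl (e : edge X) : `|d (src e) - d (tgt e)| <= 1.
  have [h1 h2] := walk_edge e.
  have w1 : walk v (geo (src e) ++ [:: (e, true)]) (tgt e) by apply/walk_cat; exists (src e).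
  have w2 : walk v (geo (tgt e) ++ [:: (e, false)]) (src e) by apply/walk_cat; exists (tgt e).
  have := geo_min w1; have := geo_min w2; rewrite !size_cat /= -!(ler_nat R) !natrD => h3 h4.
  by rewrite ler_norml /d; apply/andP; split; lra.
have [l st] := string_walk (geo_walk w).
have := point_fun_dist d0 dl st => /=.
have -> : d v = 0.
  have /geo_min : walk v [::] v by rewrite /=.
  by rewrite leqn0 /d => /eqP ->.
rewrite sub0r normrN ger0_norm//.
have := @path_dist_le_diam (at_vertex R v) (at_vertex R w) dn I I.
rewrite /d; lra.
Qed.

Lemma edge_loop_chain_loop e :
  exists q : loop v, loop_chain q = edge_loop_chain geo e.
Proof.
have [h1 _] := walk_edge e.
have w : walk v (geo (src e) ++ [:: (e, true)] ++ inv_path (geo (tgt e))) v.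
  apply/walk_cat; exists (src e) => //; apply/walk_cat; exists (tgt e) => //.
  exact: walk_inv.
exists (exist (fun p => walk v p v) _ w).
by rewrite /loop_chain !path_chain_cat path_chain_inv addrA.
Qed.

Lemma l1_edge_loop_chain e :
  (l1 (edge_loop_chain geo e) <= 2 * \max_w size (geo w) + 1)%N.
Proof.
rewrite (leq_trans (l1D _ _))// l1N.
have h1 := l1D (path_chain (geo (src e))) (path_chain [:: (e, true)]).
rewrite l1_path_chain1 in h1.
have h2 w : (l1 (path_chain (geo w)) <= \max_w size (geo w))%N.
  by rewrite (leq_trans (l1_path_chain _))// leq_bigmax.
have := h2 (src e); have := h2 (tgt e); move: h1; lia.
Qed.

End Diameter.

Lemma small_relations_loops (X : polycomplex) (v : vertex X) (M : nat)
    (c : edge X -> {ffun edge X -> int}) :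
  rationally_perfect (pi1 v) -> (0 < M)%N ->
  (forall e, exists q : loop v, loop_chain q = c e) ->
  exists r (t : 'I_r -> edge X), (M.+1 ^ r <= card_ab (pi1 v))%N /\
  forall e, exists (m : nat) (x : 'I_r -> int), [/\ (0 < m <= M)%N,
    forall i, (`|x i| <= M)%N &
    range (@bd2 X) (c e *~ m - \sum_i c (t i) *~ x i)].
Proof.
move=> perf M0 hc.
apply: (@small_relations _ _ (range (@bd2 X)) (range (@loop_chain X v))) => //.
- exact: boundary0.
- exact: boundaryB.
- by exists (loop_one v) => //; exact: path_chain_nil.
- move=> _ _ [p _ <-] [q _ <-]; exists (loop_mul p (loop_inv q)) => //.
  by rewrite loop_chain_mul loop_chain_inv.
- by move=> e; have [q hq] := hc e; exists q.
- move=> J z hz hJ.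
  have /choice [q hq] : forall j, exists q : loop v, loop_chain q = z j.
    by move=> j; have [q _ hq] := hz j; exists q.
  have [j [j' [ne hB]]] := loops_finite_index q perf hJ.
  by exists j, j'; rewrite -!hq.
Qed.

(** * Choice of [M] and the final estimate *)

Lemma exists_powR_ge (R : realType) (delta : R) (B : nat) : 0 < delta ->
  exists2 M : nat, (0 < M)%N & B%:R <= M.+1%:R `^ delta.
Proof.
move=> d0; pose M := (Num.truncn (B%:R `^ delta^-1 : R)).+1.
exists M => //.
have h : B%:R `^ delta^-1 <= M.+1%:R :> R.
  apply: le_trans (ltW (truncnS_gt _)) _.
  by rewrite ler_nat.
have : (B%:R `^ delta^-1) `^ delta <= M.+1%:R `^ delta.
  by apply: ge0_ler_powR => //; rewrite ?nnegrE ?powR_ge0// ltW.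
by rewrite -powRrM mulVf ?gt_eqF// powRr1.
Qed.

Lemma expn_le_powR (R : realType) (delta : R) (B M r N : nat) : 0 < delta ->
  B%:R <= M.+1%:R `^ delta -> (M.+1 ^ r <= N)%N -> B%:R ^+ r <= N%:R `^ delta.
Proof.
move=> d0 hB hN.
apply: (@le_trans _ _ ((M.+1%:R `^ delta) ^+ r)).
  by rewrite lerXn2r// nnegrE// powR_ge0.
rewrite -powR_mulrn ?powR_ge0// -powRrM mulrC powRrM powR_mulrn//.
by rewrite -natrX; apply: ge0_ler_powR; rewrite ?nnegrE ?ler_nat ?ler0n ?(ltW d0).
Qed.

(** Each cell in the support of a cycle is then itself a cycle, of norm 1, and these cells span all
    cycles. *)
Lemma xi2_le1 (R : realType) (X : polycomplex) :
  (forall f : face X, supports_cycle f -> bd_cell f = 0) -> xi2 R X <= 1.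
Proof.
move=> h; pose W f : {ffun face X -> int} := if supports_cycle f then single_face f else 0.
apply: (@xi2_le R X W 1) => //.
- by move=> f; rewrite /W; case: ifP => [/h|_]; rewrite ?bd2_0// bd2_single.
- by move=> f; rewrite /W; case: ifP => _; rewrite ?l1_single ?l1_0.
- move=> z hz; rewrite mulr1z -[LHS]sum_single; apply: eq_bigr => f _.
  rewrite /W; case: ifPn => // hf.
  suff -> : z f = 0 by rewrite !mulr0z.
  by apply: contraNeq hf => zf; apply/asboolP; exists z.
Qed.

Lemma size_le_kappa2 (X : polycomplex) (f : face X) :
  supports_cycle f -> (size (bd f) <= kappa2 X)%N.
Proof.
move=> hf; rewrite /kappa2 ifT; last by apply/existsP; exists f.
exact: leq_bigmax_cond.
Qed.

Section MainBound.
Variables (R : realType) (delta : R) (M : nat).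
Hypotheses (delta0 : 0 < delta) (M0 : (0 < M)%N).
Hypothesis M_ge : 26%:R <= M.+1%:R `^ delta.
Variables (X : polycomplex) (v : vertex X).
Hypothesis conn : complex_connected X.
Hypothesis perf : rationally_perfect (pi1 v).

Lemma main_bound (rho : R) (f0 : face X) :
  0 < rho -> rho1 R X = rho%:E -> supports_cycle f0 -> bd_cell f0 != 0 ->
  diam R X != 0 ->
  (xi2 R X - 1) * rho <=
  (224 * M`! * M)%N%:R * (card_ab (pi1 v))%:R `^ delta * ((kappa2 X)%:R * diam R X).
Proof.
move=> rho0 rhoE supp0 bd0 dn.
have [geo [geo_walk geo_min]] := geodesics v conn.
have loopc := edge_loop_chain_loop geo_walk.
have [r [t [rN rel]]] := small_relations_loops perf M0 loopc.
have /choice [m hm] := rel.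
have /choice [x hx] := hm.
have mb e : (0 < m e <= M)%N by have [] := hx e.
have xb e i : (`|x e i| <= M)%N by have [_ h _] := hx e.
have hrel e : range (@bd2 X) (edge_loop_chain geo e *~ m e -
    \sum_i edge_loop_chain geo (t i) *~ x e i) by have [] := hx e.
have kle (f : face X) : supports_cycle f -> (l1 (bd_cell f) <= kappa2 X)%N.
  by move=> hf; apply: leq_trans (l1_bd_cell f) (size_le_kappa2 hf).
have fill z : range (@bd2 X) z ->
    exists2 A : {ffun face X -> int}, bd2 A = z & (l1 A)%:R * rho <= (l1 z)%:R.
  by apply: fill_le => //; rewrite rhoE.
pose L := (2 * \max_w size (geo w) + 1)%N.
have core := xi2_core rho0 M0 (edge_loop_chain_bd geo)
  (l1_edge_loop_chain geo : forall e, _ <= L)%N kle fill mb xb hrel.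
(* The nonzero boundary of the single cell [f0] is a test cycle for [rho1]. *)
have rho_kappa : rho <= (kappa2 X)%:R.
  rewrite -lee_fin -rhoE; apply: (@le_trans _ _ (l1 (bd_cell f0))%:R%:E).
    apply: rho1_le => //; exists (single_face f0) => //; exact: bd2_single.
  by rewrite lee_fin ler_nat kle.
have [e0 _] : exists e : edge X, True.
  have := bd_size f0; case: (bd f0) => [//|[e b] p] _; by exists e.
have diam1 := edge_le_diam e0 dn.
(* Here [64 = 2 * 16 + 32]: the summand 1 of [L] is absorbed by [diam1]. *)
have L_le : L%:R <= 64 * diam R X.
  suff : (\max_w size (geo w))%:R <= 16 * diam R X by rewrite /L natrD natrM; lra.
  elim/big_ind: _ => [|a b ha hb|w _]; [lra | by rewrite /maxn; case: ifP | exact: geo_le_diam].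
have T_le := expn_le_powR delta0 M_ge rN.
set P := _ `^ delta in T_le *.
have P1 : 1 <= P by apply: le_trans T_le; rewrite exprn_ege1// ler1n.
have e1 : 1 <= M`!%:R :> R by rewrite ler1n fact_gt0.
have M1 : 1 <= M%:R :> R by rewrite ler1n.
have h1 : (kappa2 X * L * (M`! * M) * (3 * 26 ^ r))%N%:R <=
    (kappa2 X)%:R * (64 * diam R X) * (M`!%:R * M%:R) * (3 * P).
  rewrite !natrM natrX.
  have k0 : 0 <= (kappa2 X)%:R :> R by [].
  rewrite !ler_pM ?mulr_ge0 ?exprn_ge0//.
have h2 : (M`!%:R - 1) * rho <= M`!%:R * (kappa2 X)%:R.
  by apply: ler_pM; lra.
(* The additive term takes the shape of the main one, since [32 * diam R X], [M] and [P] are all at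
   least 1. *)
have h3 : M`!%:R * (kappa2 X)%:R <= M`!%:R * (kappa2 X)%:R * (32 * diam R X * M%:R * P).
  rewrite ler_peMr ?mulr_ge0//.
  by rewrite -[leLHS]mulr1 ler_pM// -[leLHS]mulr1 ler_pM.
have -> : (xi2 R X - 1) * rho = (xi2 R X - M`!%:R) * rho + (M`!%:R - 1) * rho by ring.
apply: (le_trans (lerD (le_trans core h1) (le_trans h2 h3))).
(* The constant is [224 = 64 * 3 + 32]. *)
by rewrite le_eqVlt !natrM; apply/orP; left; apply/eqP; ring.
Qed.

End MainBound.

Theorem theorem2p4 (R : realType) (delta : R) (hdelta : 0 < delta) :
  exists2 C : R, 0 < C &
    forall (X : polycomplex) (v : vertex X),
      complex_connected X ->
      rationally_perfect (pi1 v) ->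
      (((xi2 R X - 1) / ((kappa2 X)%:R * diam R X))%:E * rho1 R X
         <= (C * (card_ab (pi1 v))%:R `^ delta)%:E)%E.
Proof.
(* The integer [M] depends on [delta] alone, hence so does the constant. *)
have [M M0 hM] := exists_powR_ge 26 hdelta.
exists (224 * M`! * M)%N%:R; first by rewrite ltr0n !muln_gt0 fact_gt0.
move=> X v conn perf.
have r0 : (0 <= rho1 R X)%E := rho1_ge0 R X.
have k0 : 0 <= (kappa2 X)%:R * diam R X by rewrite mulr_ge0// diam_ge0.
(* If no such cell exists, [xi2_le1] makes the left side nonpositive, even when [rho1] is infinite;
   otherwise the boundary of [f0] shows that [rho1] is finite. *)
have [[f0 [supp0 bd0]]|h] := pselect (exists f : face X,
    supports_cycle f /\ bd_cell f != 0); last first.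
  apply: (@le_trans _ _ 0%E); last by rewrite lee_fin mulr_ge0 ?powR_ge0.
  rewrite mule_le0_ge0// lee_fin -[leRHS](mul0r ((kappa2 X)%:R * diam R X)^-1).
  rewrite ler_wpM2r ?invr_ge0// subr_le0; apply: xi2_le1 => f hf.
  by apply: contrapT => /eqP bf; apply: h; exists f.
have rho_fin : rho1 R X \is a fin_num.
  rewrite ge0_fin_numE//; apply: (@le_lt_trans _ _ (l1 (bd_cell f0))%:R%:E); last exact: ltry.
  by apply: rho1_le => //; exists (single_face f0) => //; exact: bd2_single.
have [rho rhoE] : exists rho, rho1 R X = rho%:E by exists (fine (rho1 R X)); rewrite fineK.
rewrite rhoE -EFinM lee_fin; rewrite rhoE lee_fin in r0.
(* Division by [0] gives [0]; this also covers an unbounded distance, where [sup] is [0]. *)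
have [d0|dn] := eqVneq (diam R X) 0.
  by rewrite d0 mulr0 invr0 mulr0 mul0r mulr_ge0 ?powR_ge0.
have [z0|rn] := eqVneq rho 0; first by rewrite z0 mulr0 mulr_ge0 ?powR_ge0.
have rho0 : 0 < rho by rewrite lt_neqAle eq_sym rn.
have kd0 : 0 < (kappa2 X)%:R * diam R X.
  rewrite mulr_gt0 ?lt_neqAle ?(eq_sym 0) ?dn ?(diam_ge0 _ v)// pnatr_eq0 -lt0n ler0n andbT.
  by apply: leq_trans (size_le_kappa2 supp0); have := bd_size f0; lia.
rewrite mulrAC ler_pdivrMr//.
exact: (main_bound hdelta M0 hM conn perf rho0 rhoE supp0 bd0 dn).
Qed.
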